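(* Let $n\ge2$, $G=\operatorname{PGL}_n(\mathbb R)$, $\Gamma=\operatorname{PGL}_n(\mathbb Z)$, $X=\Gamma\backslash G$, $H$ the diagonal subgroup. There exist a sequence of periodic $H$-orbits $x_iH$ in $X$ and constants $\alpha,\delta>0$ such that (1) every weak$^*$ limit of the $H$-invariant probability measures $\mu_{x_iH}$ on $x_iH$ has total mass $<1-\delta$; (2) the total volume of the orbits $x_iH$ with $\operatorname{disc}(x_iH)<D$ is $\gg D^\alpha$.
   Context: Periodic $H$-orbit = compact $H$-orbit; volume = covolume of $g^{-1}\Gamma g\cap H$ in $H$ for a fixed Haar measure. Discriminant of periodic $\Gamma gH$: $\det(B(e_i,e_j))$ for a $\mathbb Z$-basis $(e_i)$ of $\operatorname{Ad}(g)\mathfrak h\cap\mathfrak g_{\mathbb Z}$, with $\mathfrak g=M_n(\mathbb Q)/\mathbb QI$, $\mathfrak g_{\mathbb Z}$ the image of $M_n(\mathbb Z)$, $B(X,Y)=\operatorname{tr}(1)\operatorname{tr}(XY)-\operatorname{tr}(X)\operatorname{tr}(Y)$ (tr = trace of left multiplication on $M_n(\mathbb Q)$). Weak$^*$ limits are taken against compactly supported continuous functions on the noncompact space $X$. *)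

(* Defs.v *)
From HB Require Import structures.
From mathcomp Require Import all_boot all_order all_algebra.
From mathcomp Require Import all_classical all_reals all_analysis.
Set Implicit Arguments. Unset Strict Implicit. Unset Printing Implicit Defensive.
Import Order.TTheory GRing.Theory Num.Theory.
Import numFieldNormedType.Exports.
Local Open Scope classical_set_scope.
Local Open Scope ring_scope.

(* Model: G = PGL_n(R) = GL_n(R)/R^*,  Gamma = PGL_n(Z) = image of GL_n(Z),
   X = Gamma \ G.  A point x = Gamma g of X is represented by any
   g in GL_n(R); functions on X are functions on matrices that are
   left GL_n(Z)-invariant and right (= central) R^*-invariant on GL_n(R). *)

Section Defs.
Variable R : realType.
Variable n : nat.

Definition GLR : set 'M[R]_n := [set g | g \in unitmx].

Definition is_intmx (M : 'M[R]_n) : Prop := forall i j, M i j \is a Num.int.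

Definition GLZ : set 'M[R]_n := [set M | is_intmx M /\ `|\det M| = 1].

(* R^* . GL_n(Z): the preimage in GL_n(R) of Gamma = PGL_n(Z) *)
Definition inGammaR (M : 'M[R]_n) : Prop :=
  exists (l : R) (c : 'M[R]_n), l != 0 /\ GLZ c /\ M = l *: c.

Definition Hdiag : set 'M[R]_n := [set D | is_diag_mx D /\ D \in unitmx].

Definition Cc_X (f : 'M[R]_n -> R) : Prop :=
  (forall (c : 'M[R]_n) (l : R) (g : 'M[R]_n), GLZ c -> l != 0 -> GLR g ->
      f (l *: (c *m g)) = f g) /\
  {within GLR, continuous f} /\
  exists K : set 'M[R]_n, compact K /\ K `<=` GLR /\
    forall g, GLR g -> f g != 0 ->
      exists (c : 'M[R]_n) (l : R) (k : 'M[R]_n),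
        GLZ c /\ l != 0 /\ K k /\ g = l *: (c *m k).

Definition orbit_set (g : 'M[R]_n) : set 'M[R]_n :=
  [set m | exists c D, GLZ c /\ Hdiag D /\ m = c *m g *m D].

Definition same_orbit (g1 g2 : 'M[R]_n) : Prop := orbit_set g1 g2.

(* the orbit x H (x = Gamma g) is compact in X: it is closed in X and
   contained in the image of a compact subset of GL_n(R) *)
Definition periodicH (g : 'M[R]_n) : Prop :=
  GLR g /\
  (closure (orbit_set g) `&` GLR `<=` orbit_set g) /\
  exists K : set 'M[R]_n, compact K /\ K `<=` GLR /\
    forall D, Hdiag D ->
      exists (c : 'M[R]_n) (l : R) (k : 'M[R]_n),
        GLZ c /\ l != 0 /\ K k /\ g *m D = l *: (c *m k).

(* H = F x A (mod scalars), F = sign matrices diag(+-1,...,+-1,1),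
   A = { a(t) = diag(e^{t_1},...,e^{t_{n-1}},1) }, t in R^{n-1};
   the Haar measure on H is counting x Lebesgue(t). *)
Definition a_mx (t : 'rV[R]_(n.-1)) : 'M[R]_n :=
  \matrix_(i, j) if i == j then
     (if (insub (val i) : option 'I_n.-1) is Some k
      then expR (t ord0 k) else 1) else 0.

Definition sgn_mx (e : {ffun 'I_n.-1 -> bool}) : 'M[R]_n :=
  \matrix_(i, j) if i == j then
     (if (insub (val i) : option 'I_n.-1) is Some k
      then (if e k then -1 else 1) else 1) else 0.

Definition stab_vec (g : 'M[R]_n) (t : 'rV[R]_(n.-1)) : Prop :=
  inGammaR (g *m a_mx t *m invmx g).

Definition Vmx (v : 'I_n.-1 -> 'rV[R]_(n.-1)) : 'M[R]_(n.-1) :=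
  \matrix_(i < n.-1) v i.

Definition lattice_basis (g : 'M[R]_n) (v : 'I_n.-1 -> 'rV[R]_(n.-1)) : Prop :=
  \det (Vmx v) != 0 /\
  forall t, stab_vec g t <->
    exists c : 'I_n.-1 -> int, t = \sum_(i < n.-1) (v i) *~ (c i).

Fixpoint cube_int (k : nat) (F : (nat -> R) -> R) : R :=
  match k with
  | 0 => F (fun _ => 0)
  | k'.+1 => Rintegral lebesgue_measure [set x : R | 0 <= x <= 1]
      (fun x => cube_int k' (fun s => F (fun i => if i == k' then x else s i)))
  end.

(* integral of f against the H-invariant probability measure on x H,
   computed with the fundamental domain given by the basis v *)
Definition orbit_avg (g : 'M[R]_n) (v : 'I_n.-1 -> 'rV[R]_(n.-1))
    (f : 'M[R]_n -> R) : R :=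
  (2 ^+ n.-1)^-1 * \sum_(e : {ffun 'I_n.-1 -> bool})
     cube_int n.-1 (fun s =>
       f (g *m sgn_mx e *m a_mx (\sum_(i < n.-1) s i *: v i))).

Definition mu_orb (g : 'M[R]_n) (f : 'M[R]_n -> R) : R :=
  xget 0 [set m | exists v, lattice_basis g v /\ m = orbit_avg g v f].

Definition stabF (g : 'M[R]_n) : nat :=
  #|[set e : {ffun 'I_n.-1 -> bool} |
       `[< exists t, inGammaR (g *m sgn_mx e *m a_mx t *m invmx g) >]]|.

(* volume of x H = covolume of g^-1 Gamma g cap H in H *)
Definition orbit_vol (g : 'M[R]_n) : R :=
  xget 0 [set w | exists v, lattice_basis g v /\
     w = 2 ^+ n.-1 * `|\det (Vmx v)| / (stabF g)%:R].

Definition intlat (g M : 'M[R]_n) : Prop :=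
  is_intmx M /\ is_diag_mx (invmx g *m M *m g).

(* M_1..M_{n-1} project to a Z-basis of Ad(g)h cap g_Z in M_n/QI,
   i.e. M_1,..,M_{n-1}, I is a Z-basis of {M in M_n(Z) | M in g Diag g^-1} *)
Definition disc_basis (g : 'M[R]_n) (M : 'I_n.-1 -> 'M[R]_n) : Prop :=
  (forall i, intlat g (M i)) /\
  (forall N, intlat g N -> exists (c0 : int) (c : 'I_n.-1 -> int),
      N = (1%:M) *~ c0 + \sum_(i < n.-1) (M i) *~ (c i)) /\
  (forall (c0 : int) (c : 'I_n.-1 -> int),
      (1%:M) *~ c0 + \sum_(i < n.-1) (M i) *~ (c i) = 0 ->
      c0 = 0 /\ forall i, c i = 0).

(* tr = trace of left multiplication on M_n *)
Definition trL (X : 'M[R]_n) : R := n%:R * \tr X.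

Definition Bform (X Y : 'M[R]_n) : R :=
  trL 1%:M * trL (X *m Y) - trL X * trL Y.

Definition orbit_disc (g : 'M[R]_n) : R :=
  xget 0 [set d | exists M, disc_basis g M /\
     d = \det (\matrix_(i < n.-1, j < n.-1) Bform (M i) (M j))].

End Defs.

(* Main.v *)
(* Take [P_m = prod_(i < n) (X - i m) - 1] with [m] large. Its roots [al_j] are
   real, close to [j m], and the integers [al_j - i m] of the order [Z[al]] are
   units, because their product over [i] is [1]. The logarithms of the squares
   of [n - 1] of them form a matrix [W] close to [- 2 n (ln m) I]. Hence the
   orbit of the lattice [Z[al]], represented by the Vandermonde matrix [g] of
   the roots, is compact. A pigeonhole argument bounds the index of the lattice
   of [W] in the stabiliser, so the volumes of these orbits are bounded below,
   while the discriminants grow at most polynomially in [m]. This gives (2).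
   The covolume of the lattice is at least [m / 2] while it contains
   [(1, ..., 1)]; so the orbit stays high in the cusp for all times [s W] with
   [s] in [[0, eps]^(n-1)], where [eps] depends on [n] only. These times fill at
   least a proportion [eps^(n-1)] of the orbit, whichever basis of the
   stabiliser is used to compute averages, and this mass escapes. *)

Require Import Defs.
From HB Require Import structures.
From mathcomp Require Import all_boot all_order all_algebra.
From mathcomp Require Import all_classical all_reals all_analysis.
From mathcomp Require Import ring lra zify.
Set Implicit Arguments. Unset Strict Implicit. Unset Printing Implicit Defensive.
Import Order.TTheory GRing.Theory Num.Theory.
Import numFieldNormedType.Exports.
Local Open Scope classical_set_scope.
Local Open Scope ring_scope.

(** * Topology of matrix spaces *)

Section MatrixTopology.
Variable R : realType.

(** [mu_orb] and [orbit_vol] read off an unspecified basis of the stabiliser and fall back to 0 when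
    there is none. A basis must therefore be shown to exist, while only the finite-index sublattice
    spanned by [W] is explicit. To pass from one to the other, no change of variables is made in the
    iterated integral: if [W = A V] with [V] the given basis, a function periodic under [V] has the
    same Riemann sum over the [N]-torsion points in the coordinates of [V] and of [W], as soon as
    [N] is prime to [det A]. The time spent in the cusp is then counted on the side of [W]. Squares
    of units appear because the component [a(t)] of [H] only has positive entries. The orbits must
    also be pairwise distinct. The first row of each Vandermonde matrix consists of ones, and this
    normalisation forces two representatives of one orbit to have the same [|det|], whereas [|det|]
    increases strictly with [m]. *)

Lemma continuous_mx (T : topologicalType) m n (f : T -> 'M[R]_(m, n)) x :
  (forall i j, continuous_at x (fun t => f t i j)) -> continuous_at x f.
Proof.
move=> cf A [P fP] PA; apply: (filterS (P := fun t => forall i j, P i j (f t i j))).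
  by move=> t Pt; exact: PA.
apply: filter_forall => i; apply: filter_forall => j.
exact: (cf i j _ (fP i j)).
Qed.

Lemma continuous_fun_mul (T : topologicalType) (f g : T -> R) x :
  continuous_at x f -> continuous_at x g ->
  continuous_at x (fun t => f t * g t).
Proof. exact: continuousM. Qed.

Lemma continuous_fun_comp (S T U : topologicalType) (f : S -> T) (g : T -> U) x :
  continuous_at x f -> continuous_at (f x) g -> continuous_at x (fun t => g (f t)).
Proof. exact: continuous_comp. Qed.

Lemma continuous_fun_sum (T : topologicalType) (I : finType) (f : I -> T -> R) x :
  (forall i, continuous_at x (f i)) ->
  continuous_at x (fun t => \sum_i f i t).
Proof. by move=> cf; apply: (cvg_big (U := R) add_continuous) => i _; exact: cf. Qed.

Lemma continuous_det n : continuous (fun A : 'M[R]_n => \det A).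
Proof.
rewrite /determinant; apply: continuous_big; first exact: add_continuous.
move=> s _ A; apply: continuous_fun_mul; first exact: cst_continuous.
apply: (continuous_big (U := R) mul_continuous) => i _; exact: coord_continuous.
Qed.

Lemma continuous_mulmx (T : topologicalType) m n p (f : T -> 'M[R]_(m, n))
    (g : T -> 'M[R]_(n, p)) x :
  continuous_at x f -> continuous_at x g ->
  continuous_at x (fun t => f t *m g t).
Proof.
move=> cf cg; apply: continuous_mx => i j.
rewrite (_ : (fun t => _) = (fun t => \sum_k f t i k * g t k j)); last first.
  by apply/funext => t; rewrite mxE.
apply: continuous_fun_sum => k; apply: continuous_fun_mul.
  by apply: (continuous_comp (g := fun M : 'M[R]__ => M i k)) => //; exact: coord_continuous.
by apply: (continuous_comp (g := fun M : 'M[R]__ => M k j)) => //; exact: coord_continuous.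
Qed.

(** Off [unitmx], [invmx] is the identity by convention. The adjugate formula is thus only available
    near [A], where the determinant stays nonzero. *)
Lemma continuous_invmx n (A : 'M[R]_n) :
  A \in unitmx -> continuous_at A (@invmx R n).
Proof.
move=> uA; have detA : \det A != 0 by rewrite -unitfE -unitmxE.
have adjE : {near nbhs A, (fun B : 'M[R]_n => (\det B)^-1 *: \adj B) =1 @invmx R n}.
  have := @continuous_det n A; move=> /cvgr_neq0 /(_ detA).
  apply: filterS => B detB; rewrite /invmx unitmxE unitfE ifT //.
suff : continuous_at A (fun B : 'M[R]_n => (\det B)^-1 *: \adj B).
  rewrite /continuous_at (_ : (\det A)^-1 *: \adj A = invmx A).
    move=> cA P AP; have := cA P AP.
    by apply: filterS2 adjE => B /= <-.
  by rewrite /invmx uA.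
apply: continuous_mx => i j.
rewrite (_ : (fun t => _) = (fun t : 'M[R]_n => (\det t)^-1 * \adj t i j)); last first.
  by apply/funext => t; rewrite mxE.
apply: continuous_fun_mul; first by apply: continuousV => //; exact: continuous_det.
rewrite (_ : (fun t => _) = (fun t : 'M[R]_n =>
    (-1) ^+ (j + i) * \det (row' j (col' i t)))); last first.
  by apply/funext => t; rewrite mxE.
apply: continuous_fun_mul; first exact: cst_continuous.
apply: (@continuous_fun_comp _ _ _ (fun t : 'M[R]_n => row' j (col' i t))
  (fun A : 'M[R]_n.-1 => \det A)); last exact: continuous_det.
apply: continuous_mx => a b.
rewrite (_ : (fun t => _) = (fun t : 'M[R]_n => t (lift j a) (lift i b))); last first.
  by apply/funext => t; rewrite !mxE.
exact: coord_continuous.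
Qed.

Lemma compact_box n (B : R) :
  compact [set M : 'M[R]_n | forall i j, `|M i j| <= B].
Proof.
have cb : compact [set v : 'rV[R]_(n * n) | forall i, `[- B, B]%classic (v ord0 i)].
  apply: (@rV_compact _ _ (fun=> `[- B, B]%classic)) => _; exact: segment_compact.
suff -> : [set M : 'M[R]_n | forall i j, `|M i j| <= B] =
   [set vec_mx v | v in [set v : 'rV[R]_(n * n) | forall i, `[- B, B]%classic (v ord0 i)]].
  apply: continuous_compact => //; apply: continuous_subspaceT => v.
  apply: continuous_mx => i j.
  rewrite (_ : (fun t => _) = (fun t : 'rV[R]_(n * n) => t ord0 (mxvec_index i j))).
    exact: coord_continuous.
  by apply/funext => t; rewrite mxE.
apply/seteqP; split => [M MB | _ [v vB <-] i j] /=; last first.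
  by rewrite mxE; have := vB (mxvec_index i j); rewrite /= in_itv /= ler_norml.
exists (mxvec M); last by rewrite mxvecK.
by move=> k; case/mxvec_indexP: k => i j; rewrite mxvecE /= in_itv /= -ler_norml.
Qed.

(** For [b > 0] the lower bound on the determinant keeps the box inside [GLR]; this gives the
    compact set that [periodicH] asks for. *)
Lemma compact_box_det n (B b : R) :
  compact [set M : 'M[R]_n | (forall i j, `|M i j| <= B) /\ b <= `|\det M|].
Proof.
apply: subclosed_compact (@compact_box n B) _; last by move=> M [].
have -> : [set M : 'M[R]_n | (forall i j, `|M i j| <= B) /\ b <= `|\det M|] =
  [set M : 'M[R]_n | forall i j, `|M i j| <= B] `&`
  (fun M : 'M[R]_n => `|\det M|) @^-1` [set x | b <= x] by [].
apply: closedI.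
  apply: compact_closed; last exact: compact_box.
  exact: norm_hausdorff.
apply: preimage_closed; last exact: closed_ge.
move=> M _; apply: (@continuous_fun_comp _ _ _ (fun A : 'M[R]_n => \det A) (fun x : R => `|x|)).
  exact: continuous_det.
exact: norm_continuous.
Qed.

(** Near-covering compactness makes the radius uniform in [x]. Closeness is measured coordinate by
    coordinate, as in the modulus of continuity of the iterated integrals. *)
Lemma compact_unif_continuous k (K : set 'rV[R]_k) (F : 'rV[R]_k -> R) (eta : R) :
  compact K -> (forall x, K x -> continuous_at x F) -> 0 < eta ->
  exists2 d : R, 0 < d & forall x y : 'rV[R]_k, K x -> (forall i, `|x ord0 i - y ord0 i| < d) ->
    `|F x - F y| <= eta.
Proof.
move=> /compact_near_coveringP cK cF eta0.
have [|d] := cK R (0^'+) (fun d x => forall y : 'rV[R]_k,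
    (forall i, `|x ord0 i - y ord0 i| < d) -> `|F x - F y| <= eta) _ _.
  move=> x Kx; have /cvgrPdist_lt /(_ (eta / 2)) := cF x Kx.
  have e20 : 0 < eta / 2 by rewrite divr_gt0.
  move=> /(_ e20) /nbhs_ballP [e /= e0 eF].
  exists (ball x (e / 2), [set d | d < e / 2]) => /=.
    split; first by apply: nbhsx_ballx; rewrite divr_gt0.
    by apply: nbhs_right_lt; rewrite divr_gt0.
  move=> [z d] /= [[_ xz] de] y zy.
  have Fz : `|F x - F z| < eta / 2.
    apply: eF; split => // i j; apply: lt_le_trans (xz i j) _.
    by rewrite ler_pdivrMr // ler_peMr ?ler1n // ltW.
  have Fy : `|F x - F y| < eta / 2.
    apply: eF; split => // i j; rewrite [e]splitr /ball /= ord1.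
    apply: le_lt_trans (ler_distD (z ord0 j) _ _) _; apply: ltrD.
      by have := xz ord0 j; rewrite /ball /=.
    exact: lt_trans (zy j) de.
  apply: le_trans (ler_distD (F x) _ _) _.
  by rewrite [eta]splitr lerD // ltW // distrC.
move=> /= d0 Hd.
exists (d / 2) => //; first by rewrite divr_gt0.
move=> x y Kx xy; apply: (Hd (d / 2)) => //.
  by rewrite /ball_ /= sub0r normrN gtr0_norm ?divr_gt0 // ltr_pdivrMr // ltr_pMr // ltr1n.
by rewrite divr_gt0.
Qed.

End MatrixTopology.

(** * Iterated integrals and Riemann sums *)

Section CubeIntegral.
Variable R : realType.
Implicit Types (F : (nat -> R) -> R) (G : R -> R) (s : nat -> R).

Local Notation mu := (@lebesgue_measure R).

Definition unit_cube s := forall i, 0 <= s i <= 1.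

(** No closeness is asked of the coordinates from [k] on. If this holds for every [eta] with a
    suitable [d], then on the unit cube [F] depends on its first [k] coordinates only. *)
Definition mod_cont (eta d : R) k F := forall s s', unit_cube s -> unit_cube s' ->
  (forall i, (i < k)%N -> `|s i - s' i| < d) -> `|F s - F s'| <= eta.

Definition cube_cont k F :=
  forall eta : R, 0 < eta -> exists2 d, 0 < d & mod_cont eta d k F.

Definition slice k (x : R) F : (nat -> R) -> R :=
  fun s => F (fun i => if i == k then x else s i).

Lemma mod_cont_slice (eta d : R) k x F : 0 < d -> 0 <= x <= 1 ->
  mod_cont eta d k.+1 F -> mod_cont eta d k (slice k x F).
Proof.
move=> d0 x01 mF s s' cs cs' ss'; apply: mF => i; do ?by case: ifP.
rewrite ltnS leq_eqVlt; case: eqP => [_ _|_ /= ik]; last exact: ss'.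
by rewrite subrr normr0.
Qed.

Lemma cube_cont_slice k x F : 0 <= x <= 1 ->
  cube_cont k.+1 F -> cube_cont k (slice k x F).
Proof.
move=> x01 cF eta /cF[d d0 mF]; exists d => //; exact: mod_cont_slice.
Qed.

Lemma slice_dist (eta d : R) k x x' F s : 0 < d -> 0 <= x <= 1 -> 0 <= x' <= 1 ->
  mod_cont eta d k.+1 F -> unit_cube s -> `|x - x'| < d ->
  `|slice k x F s - slice k x' F s| <= eta.
Proof.
move=> d0 x01 x01' mF cs xx'; apply: mF => i; do ?by case: ifP.
by case: eqP => // _; rewrite subrr normr0.
Qed.

Lemma integrable_unit_interval G :
  (forall eta, 0 < eta -> exists2 d, 0 < d & forall x y, 0 <= x <= 1 -> 0 <= y <= 1 ->
     `|x - y| < d -> `|G x - G y| <= eta) ->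
  mu.-integrable `[0, 1] (EFin \o G).
Proof.
move=> cG; apply: continuous_compact_integrable; first exact: segment_compact.
apply/subspace_continuousP => x; rewrite /= in_itv /= => x01.
apply/cvgrPdist_le => e /cG[d d0 dG]; rewrite near_withinE.
apply/nbhs_ballP; exists d => //= y xy; rewrite in_itv /= => y01.
exact: dG.
Qed.

Lemma itv01E : [set x : R | 0 <= x <= 1] = `[0, 1]%classic.
Proof. by apply/seteqP; split => x /=; rewrite in_itv. Qed.

Lemma integrable_itv_cst (a b : R) (I : interval R) (c : R) :
  [set` I] `<=` `[a, b]%classic -> mu.-integrable [set` I] (EFin \o (fun _ : R => c)).
Proof.
move=> Iab; apply: (@integrableS _ _ _ mu `[a, b]%classic) => //.
apply: continuous_compact_integrable; first exact: segment_compact.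
by apply: continuous_subspaceT => x; exact: cst_continuous.
Qed.

(** Both shapes of interval occur: closed for the whole unit interval, half-open for the pieces of a
    Riemann sum. *)
Lemma Rintegral_dist_le (a b : R) (I : interval R) G1 G2 (e : R) :
  (I = `]a, b] \/ I = `[a, b]) -> a <= b ->
  mu.-integrable [set` I] (EFin \o G1) -> mu.-integrable [set` I] (EFin \o G2) ->
  (forall x, [set` I] x -> `|G1 x - G2 x| <= e) ->
  `|\int[mu]_(x in [set` I]) G1 x - \int[mu]_(x in [set` I]) G2 x| <= e * (b - a).
Proof.
move=> HI ab i1 i2 le12.
have mI : measurable [set` I] by exact: measurable_itv.
have muI : mu [set` I] = (b - a)%:E.
  case: HI => ->; rewrite lebesgue_measure_itv /= lte_fin; case: ltP => // ba;
    by rewrite (le_anti (x := a) (y := b)) ?ab // subrr.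
have ce : mu.-integrable [set` I] (EFin \o (fun _ : R => e)).
  apply: (@integrable_itv_cst a b); case: HI => -> // x /=; rewrite !in_itv /=.
  by move=> /andP[/ltW -> ->].
rewrite -RintegralB //.
apply: le_trans (le_normr_Rintegral _ _) _ => //.
  rewrite (_ : EFin \o _ = (EFin \o G1) \- (EFin \o G2))%E; last by apply/funext.
  exact: integrableB.
apply: le_trans (le_Rintegral (f2 := fun _ => e) _ _ _ _) _ => //.
  apply: (@integrable_norm _ _ _ mu _ (fun x => G1 x - G2 x)).
  rewrite (_ : EFin \o _ = (EFin \o G1) \- (EFin \o G2))%E; last by apply/funext.
  exact: integrableB.
have -> : \int[mu]_(_ in [set` I]) e = e * fine (mu [set` I]) by exact: Rintegral_cst.
by rewrite muI.
Qed.

(** The induction hypothesis serves twice: applied to two slices of one function it shows that the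
    outer integrand is uniformly continuous, hence integrable; applied to slices of [F1] and [F2] it
    gives the estimate. *)
Lemma cube_int_dist k F1 F2 (e : R) : cube_cont k F1 -> cube_cont k F2 ->
  (forall s, unit_cube s -> `|F1 s - F2 s| <= e) ->
  `|cube_int k F1 - cube_int k F2| <= e.
Proof.
elim: k F1 F2 e => [|k IH] F1 F2 e c1 c2 le12 /=.
  by apply: le12 => i; rewrite lexx ler01.
have iG F : cube_cont k.+1 F ->
    mu.-integrable `[0, 1] (EFin \o (fun x => cube_int k (slice k x F))).
  move=> cF; apply: integrable_unit_interval => eta /cF[d d0 mF].
  exists d => // x y x01 y01 xy; apply: IH; do ?exact: cube_cont_slice.
  by move=> s cs; apply: slice_dist xy.
rewrite itv01E.
have := @Rintegral_dist_le 0 1 `[0, 1] _ _ e (or_intror erefl) ler01 (iG _ c1) (iG _ c2).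
rewrite subr0 mulr1; apply => x /=; rewrite in_itv /= => x01.
apply: IH; do ?exact: cube_cont_slice.
by move=> s cs; apply: le12 => i; case: ifP.
Qed.

Lemma slice_modulus (eta d : R) k F : 0 < d -> cube_cont k.+1 F -> mod_cont eta d k.+1 F ->
  forall x y, 0 <= x <= 1 -> 0 <= y <= 1 -> `|x - y| < d ->
  `|cube_int k (slice k x F) - cube_int k (slice k y F)| <= eta.
Proof.
move=> d0 cF mF x y x01 y01 xy; apply: cube_int_dist; do ?exact: cube_cont_slice.
by move=> s cs; apply: slice_dist xy.
Qed.

(** Left-endpoint Riemann sum, with the recursion of [cube_int], so that the two are compared one
    coordinate at a time. *)
Fixpoint riem (N k : nat) F : R :=
  match k with
  | 0 => F (fun _ => 0)
  | k'.+1 => N%:R^-1 * \sum_(j < N) riem N k' (slice k' (j%:R / N%:R) F)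
  end.

Lemma riemann_sum_dist G N (eta d : R) : (0 < N)%N -> N%:R^-1 < d ->
  mu.-integrable `[0, 1] (EFin \o G) ->
  (forall x y, 0 <= x <= 1 -> 0 <= y <= 1 -> `|x - y| < d -> `|G x - G y| <= eta) ->
  `|\int[mu]_(x in `[0, 1]) G x - N%:R^-1 * \sum_(j < N) G (j%:R / N%:R)| <= eta.
Proof.
move=> N0 Nd iG mG.
have N0' : 0 < N%:R :> R by rewrite ltr0n.
have sub01 m (I : interval R) : (m <= N)%N -> (I = `[0, m%:R / N%:R] \/
    exists2 j, (j <= m)%N & I = `]j%:R / N%:R, m%:R / N%:R]) ->
    [set` I] `<=` `[0, 1]%classic.
  move=> mN HI x /= xI.
  have m1 : m%:R / N%:R <= 1 :> R by rewrite ler_pdivrMr // mul1r ler_nat.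
  case: HI xI => [->|[j jm ->]]; rewrite !in_itv /= => /andP[x0 x1];
    rewrite (le_trans x1 m1) ?x0 // andbT //.
  by apply: le_trans (ltW x0); rewrite divr_ge0.
(* Induction on the number [m] of pieces: each piece, of length [1/N], costs at most [eta / N]. *)
suff H m : (m <= N)%N -> `|\int[mu]_(x in `[0, m%:R / N%:R]) G x -
    N%:R^-1 * \sum_(j < m) G (j%:R / N%:R)| <= eta * (m%:R / N%:R).
  by have := H N (leqnn N); rewrite divff ?mulr1 // gt_eqF.
elim: m => [|m IH] mN.
  by rewrite big_ord0 mulr0 mul0r set_itv1 Rintegral_set1 subrr normr0 mulr0.
have mm : (m%:R / N%:R : R) <= m.+1%:R / N%:R.
  by rewrite ler_pM2r ?invr_gt0 // ler_nat.
have i1 : mu.-integrable `[0, m.+1%:R / N%:R] (EFin \o G).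
  by apply: integrableS iG => //; apply: (sub01 m.+1) => //; left.
have i2 : mu.-integrable `]m%:R / N%:R, m.+1%:R / N%:R] (EFin \o G).
  by apply: integrableS iG => //; apply: (sub01 m.+1) => //; right; exists m.
have := @Rintegral_itvB R G (BLeft 0) (BRight (m.+1%:R / N%:R)) (m%:R / N%:R) i1.
rewrite !bnd_simp divr_ge0 // => /(_ isT mm) /eqP; rewrite subr_eq => /eqP ->.
rewrite big_ord_recr /= mulrDr.
have dist : `|\int[mu]_(x in `]m%:R / N%:R, m.+1%:R / N%:R]) G x -
    N%:R^-1 * G (m%:R / N%:R)| <= eta * (m.+1%:R / N%:R - m%:R / N%:R).
  have dE : m.+1%:R / N%:R - m%:R / N%:R = N%:R^-1 :> R.
    by rewrite -mulrBl -natrB // subSnn mul1r.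
  have -> : N%:R^-1 * G (m%:R / N%:R) =
     \int[mu]_(x in `]m%:R / N%:R, m.+1%:R / N%:R]) (fun _ => G (m%:R / N%:R)) x.
    rewrite Rintegral_cst //= mulrC lebesgue_measure_itv /= lte_fin.
    by rewrite ltr_pM2r ?invr_gt0 // ltr_nat ltnSn -EFinB dE.
  apply: Rintegral_dist_le => //; first by left.
    apply: (@integrable_itv_cst 0 1); apply: (sub01 m.+1) => //.
    by right; exists m.
  move=> x xI; have x01 := sub01 m.+1 _ mN (or_intror (ex_intro2 _ _ m (leqnSn m) erefl)) x xI.
  move: xI x01; rewrite /= !in_itv /= => /andP[mx xm] x01.
  apply: mG => //; first by rewrite divr_ge0 //= ler_pdivrMr // mul1r ler_nat ltnW.
  rewrite gtr0_norm ?subr_gt0 //; apply: le_lt_trans Nd.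
  by rewrite -[leRHS]dE lerD2r.
have -> : eta * (m.+1%:R / N%:R) =
    eta * (m.+1%:R / N%:R - m%:R / N%:R) + eta * (m%:R / N%:R).
  by rewrite -mulrDr subrK.
rewrite [X in _ - X]addrC opprD addrACA; apply: le_trans (ler_normD _ _) _.
by rewrite lerD // IH // ltnW.
Qed.

Lemma cube_int_riem k N F (eta d : R) : (0 < N)%N -> N%:R^-1 < d ->
  cube_cont k F -> mod_cont eta d k F ->
  `|cube_int k F - riem N k F| <= k%:R * eta.
Proof.
move=> N0 Nd; have d0 : 0 < d by apply: lt_trans Nd; rewrite invr_gt0 ltr0n.
elim: k F => [|k IH] F cF mF /=; first by rewrite subrr normr0 mul0r.
have N0' : 0 < N%:R :> R by rewrite ltr0n.
rewrite itv01E.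
set I1 := Rintegral _ _ _.
pose S := N%:R^-1 * \sum_(j < N) cube_int k (slice k (j%:R / N%:R) F).
have D1 : `|I1 - S| <= eta.
  apply: (@riemann_sum_dist (fun x => cube_int k (slice k x F)) N eta d) => //.
    apply: integrable_unit_interval => e /cF[d' d'0 mF'].
    by exists d' => //; apply: slice_modulus.
  exact: slice_modulus.
apply: le_trans (ler_distD S _ _) _.
rewrite -natr1 mulrDl mul1r addrC lerD //.
rewrite -mulrBr normrM gtr0_norm ?invr_gt0 // mulrC ler_pdivrMr // -sumrB.
apply: le_trans (ler_norm_sum _ _ _) _.
apply: le_trans (ler_sum _ (G := fun _ => k%:R * eta) _) _.
  move=> j _; have j01 : 0 <= (j%:R / N%:R : R) <= 1.
    by rewrite divr_ge0 //= ler_pdivrMr // mul1r ler_nat ltnW.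
  by apply: IH; [exact: cube_cont_slice|exact: mod_cont_slice].
by rewrite sumr_const card_ord mulr_natr.
Qed.

Definition grid_pt N k (j : {ffun 'I_k -> 'I_N}) : nat -> R :=
  fun i => if insub i is Some i' then (j i')%:R / N%:R else 0.

Arguments grid_pt {N k} j.

(** As a single sum over a finite grid, the Riemann sum can be reindexed by a permutation of the
    torsion points. *)
Lemma riemE N k F :
  riem N k F = N%:R^-1 ^+ k * \sum_(j : {ffun 'I_k -> 'I_N}) F (grid_pt j).
Proof.
elim: k F => [|k IH] F /=.
  have H (j : {ffun 'I_0 -> 'I_N}) : grid_pt j = fun _ => 0.
    by apply/funext => i; rewrite /grid_pt; case: insubP.
  rewrite expr0 mul1r (eq_bigr _ (fun j _ => congr1 F (H j))).
  by rewrite sumr_const card_ffun !card_ord expn0.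
under eq_bigr do rewrite IH.
rewrite -mulr_sumr mulrA -exprS; congr (_ * _).
rewrite pair_bigA /=.
pose h (p : 'I_N * {ffun 'I_k -> 'I_N}) : {ffun 'I_k.+1 -> 'I_N} :=
  [ffun i => if unlift ord_max i is Some i' then p.2 i' else p.1].
pose h' (f : {ffun 'I_k.+1 -> 'I_N}) : 'I_N * {ffun 'I_k -> 'I_N} :=
  (f ord_max, [ffun i => f (lift ord_max i)]).
rewrite (reindex h) /=; last first.
  exists h' => [[x j] _ | f _].
    rewrite /h /h' ffunE unlift_none /=; congr pair.
    by apply/ffunP => i; rewrite !ffunE liftK.
  by apply/ffunP => i; rewrite ffunE; case: unliftP => [i'|] -> //=; rewrite ffunE.
apply: eq_bigr => -[x j] _ /=; rewrite /slice; congr F.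
apply/funext => i; rewrite /grid_pt.
case: eqP => [->|ik].
  case: insubP => [u _ uk|]; last by rewrite ltnSn.
  by rewrite ffunE (_ : u = ord_max) ?unlift_none //; apply: val_inj.
case: insubP => [u ult uE|]; case: insubP => [v vlt vE|] //.
- rewrite ffunE (_ : v = lift ord_max u) ?liftK //.
  by apply: val_inj; rewrite /= vE /bump leqNgt ltn_ord add0n uE.
- by rewrite ltnS ltnW.
- rewrite -leqNgt => ki; case: (ik).
  by apply/eqP; rewrite eqn_leq ki -ltnS -vE ltn_ord.
Qed.

End CubeIntegral.

(** * Lattices *)

Section Lattices.
Variable R : realType.
Variable k : nat.
Implicit Types (x y : 'rV[R]_k) (V W : 'M[R]_k).

Local Notation zr := (map_mx (intr : int -> R)).

Section Subgroup.
Variable Lam : 'rV[R]_k -> Prop.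
Hypothesis Lam0 : Lam 0.
Hypothesis LamB : forall x y, Lam x -> Lam y -> Lam (x - y).

Lemma subgroup_opp x : Lam x -> Lam (- x).
Proof. by move=> Lx; rewrite -sub0r; apply: LamB. Qed.

Lemma subgroup_add x y : Lam x -> Lam y -> Lam (x + y).
Proof. by move=> Lx Ly; rewrite -[y]opprK; apply: LamB => //; exact: subgroup_opp. Qed.

Lemma subgroup_natmul x n : Lam x -> Lam (x *+ n).
Proof.
move=> Lx; elim: n => [|n IH]; first by rewrite mulr0n.
by rewrite mulrS; apply: subgroup_add.
Qed.

Lemma subgroup_intscale x (c : int) : Lam x -> Lam (c%:~R *: x).
Proof.
move=> Lx; rewrite scaler_int; case: c => n; first exact: subgroup_natmul.
by rewrite NegzE mulrNz; apply: subgroup_opp; exact: subgroup_natmul.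
Qed.

Lemma subgroup_comb V (c : 'rV[int]_k) :
  (forall i, Lam (row i V)) -> Lam (zr c *m V).
Proof.
move=> LV; rewrite mulmx_sum_row.
elim/big_ind : _ => // [x y|i _]; first exact: subgroup_add.
by rewrite mxE; apply: subgroup_intscale.
Qed.

End Subgroup.

Definition fracrow (x : 'rV[R]_k) : 'rV[R]_k :=
  \row_i (x ord0 i - (Num.floor (x ord0 i))%:~R).

Definition floorrow (x : 'rV[R]_k) : 'rV[int]_k := \row_i Num.floor (x ord0 i).

Lemma floor_frac x : x = zr (floorrow x) + fracrow x.
Proof. by apply/rowP => i; rewrite !mxE addrC subrK. Qed.

Lemma fracrow_itv x i : 0 <= fracrow x ord0 i < 1.
Proof.
rewrite mxE subr_ge0 ltrBlDl; have /andP[-> h] := floor_itv (x ord0 i).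
by move: h; rewrite intrD addrC.
Qed.

Lemma fracrow_mul_le (W : 'M[R]_k) (b : R) x i : (forall i j, `|W i j| <= b) ->
  `|(fracrow x *m W) ord0 i| <= k%:R * b.
Proof.
move=> Wb; rewrite mxE; apply: le_trans (ler_norm_sum _ _ _) _.
apply: le_trans (ler_sum _ (G := fun _ => b) _) _.
  move=> j _; rewrite normrM -[b]mul1r ler_pM //.
  have /andP[f0 f1] := fracrow_itv x j.
  by rewrite ger0_norm // ltW.
by rewrite sumr_const card_ord [leRHS]mulr_natl.
Qed.

Lemma dist_same_floor (a b c : R) :
  c <= a -> a < c + 1 -> c <= b -> b < c + 1 -> `|a - b| < 1.
Proof. by move=> *; rewrite ltr_norml; apply/andP; split; lra. Qed.

Lemma map_intr_inj m n : injective (@map_mx int R intr m n).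
Proof.
move=> A B /matrixP AB; apply/matrixP => i j; apply: (@intr_inj R).
by have := AB i j; rewrite !mxE.
Qed.

(** * Separated subgroups containing a known full-rank lattice *)

Section Separated.
Variable Lam : 'rV[R]_k -> Prop.
Hypothesis Lam0 : Lam 0.
Hypothesis LamB : forall x y, Lam x -> Lam y -> Lam (x - y).
Variable r : R.
Hypothesis r_gt0 : 0 < r.
Hypothesis Lam_sep : forall x, Lam x -> (forall i, `|x ord0 i| < r) -> x = 0.
Variable W : 'M[R]_k.
Hypothesis LamW : forall i, Lam (row i W).
Hypothesis W_unit : W \in unitmx.
Variables (b : R) (M : nat).
Hypothesis Wb : forall i j, `|W i j| <= b.
Hypothesis bM : 2 * k%:R * b < M.+1%:R * r.

(* Reduce modulo [W] into the fundamental parallelepiped and cut the latter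
   into [M.+1 ^ k] boxes of side [r]. *)
Lemma card_incongruent (T : finType) (p : T -> 'rV[R]_k) :
  (forall t, Lam (p t)) ->
  (forall t t', (exists c : 'rV[int]_k, p t - p t' = zr c *m W) -> t = t') ->
  (#|T| <= M.+1 ^ k)%N.
Proof.
move=> Lp pinj.
pose fl t := floorrow (p t *m invmx W).
pose fr t := fracrow (p t *m invmx W).
pose q t := fr t *m W.
have qE t : p t = zr (fl t) *m W + q t.
  by rewrite -mulmxDl -floor_frac mulmxKV.
have Lq t : Lam (q t).
  have -> : q t = p t - zr (fl t) *m W by rewrite qE addrC addKr.
  by apply: LamB => //; apply: subgroup_comb.
have qb t i : `|q t ord0 i| <= k%:R * b by exact: fracrow_mul_le.
pose z t i := (q t ord0 i + k%:R * b) / r.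
have z0 t i : 0 <= z t i.
  rewrite /z divr_ge0 ?(ltW r_gt0) //.
  by have := qb t i; rewrite ler_norml => /andP[+ _]; rewrite -lerBlDr sub0r.
have zM t i : z t i < M.+1%:R.
  rewrite /z ltr_pdivrMr //; apply: le_lt_trans bM.
  have -> : 2 * k%:R * b = k%:R * b + k%:R * b by ring.
  rewrite lerD2r.
  by have := qb t i; rewrite ler_norml => /andP[_].
have fz0 t i : 0 <= Num.floor (z t i) by rewrite floor_ge0.
have fzM t i : (`|Num.floor (z t i)| < M.+1)%N.
  rewrite -ltz_nat gez0_abs // -(ltr_int R); apply: le_lt_trans (zM t i).
  by have /andP[] := floor_itv (z t i).
pose cell t : {ffun 'I_k -> 'I_M.+1} := [ffun i => Ordinal (fzM t i)].
suff cinj : injective cell.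
  by have := leq_card cell cinj; rewrite card_ffun !card_ord.
move=> t t' /ffunP tt'; apply: pinj.
exists (fl t - fl t').
suff qq : q t = q t'.
  by rewrite (qE t) (qE t') qq map_mxB mulmxBl opprD addrACA subrr addr0.
apply/eqP; rewrite -subr_eq0; apply/eqP; apply: Lam_sep; first exact: LamB.
move=> i; have := congr1 val (tt' i); rewrite !ffunE /= => fzz.
have {}fzz : Num.floor (z t i) = Num.floor (z t' i).
  by rewrite -(gez0_abs (fz0 t i)) -(gez0_abs (fz0 t' i)) fzz.
have /andP[l1 u1] := floor_itv (z t i); have /andP[l2 u2] := floor_itv (z t' i).
rewrite fzz intrD in l1 u1; rewrite intrD in u2.
have -> : (q t - q t') ord0 i = (z t i - z t' i) * r.
  rewrite [LHS]mxE [X in _ + X]mxE /z -mulrBl divfK ?gt_eqF //.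
  by rewrite opprD addrACA subrr addr0.
rewrite normrM (gtr0_norm r_gt0) gtr_pMl //.
exact: dist_same_floor l1 u1 l2 u2.
Qed.

(** Pigeonhole on the multiples [0, x, 2x, ...]: two of the first [M.+1 ^ k + 1] agree modulo the
    lattice of [W]. The factorial is a common multiple of all possible differences, so that one
    exponent works for every [x]. *)
Lemma multiple_in_sublattice x : Lam x ->
  exists c : 'rV[int]_k, x *+ (M.+1 ^ k)`! = zr c *m W.
Proof.
move=> Lx; set B := (M.+1 ^ k)%N.
have [[d [/andP[d1 dB] [c dc]]]|H] := pselect (exists d, (0 < d <= B)%N /\
    exists c : 'rV[int]_k, x *+ d = zr c *m W).
  have /dvdnP[e ->] : (d %| B`!)%N by rewrite dvdn_fact // d1.
  exists (c *+ e); rewrite mulnC mulrnA dc.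
  have -> : zr (c *+ e) = zr c *+ e.
    by apply/matrixP => i j; rewrite mxE !mulmxnE mxE; exact: rmorphMn.
  by rewrite -scaler_nat -[zr c *+ e]scaler_nat scalemxAl.
suff : (B.+1 <= B)%N by rewrite ltnn.
rewrite -[B.+1]card_ord; apply: (@card_incongruent 'I_B.+1 (fun j => x *+ j)).
- by move=> t; apply: subgroup_natmul.
- move=> t t' [c tc]; apply/eqP; case: eqP => // /eqP neq; case: H.
  wlog lt : t t' c tc neq / (t' < t)%N.
    move=> wl; case: (ltngtP t t') => [lt|lt|/val_inj eq]; last by rewrite eq eqxx in neq.
      apply: (wl t' t (- c)) => //; last by rewrite eq_sym.
      by rewrite -opprB tc map_mxN mulNmx.
    exact: (wl t t' c).
  exists (t - t')%N; rewrite subn_gt0 lt /=; split.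
    by rewrite leq_subLR; apply: leq_trans (leq_addl _ _); rewrite -ltnS.
  by exists c; rewrite mulrnBr // ltnW.
Qed.

(** Cramer's rule: the new matrix is [E V], where [E] is the identity with row [i] replaced by
    [f]. *)
Lemma det_replace_row V (f : 'rV[R]_k) (i : 'I_k) :
  \det (\matrix_(j, l) (if j == i then (f *m V) ord0 l else V j l)) =
  f ord0 i * \det V.
Proof.
pose E : 'M[R]_k := \matrix_(j, l) (if j == i then f ord0 l else (j == l)%:R).
have -> : (\matrix_(j, l) (if j == i then (f *m V) ord0 l else V j l)) = E *m V.
  apply/matrixP => j l; rewrite !mxE; case: eqP => [->|ji].
    by apply: eq_bigr => a _; rewrite !mxE eqxx.
  rewrite (bigD1 j) //= big1 ?addr0 => [|a aj]; rewrite !mxE; case: eqP => // _.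
    by rewrite eqxx mul1r.
  by rewrite eq_sym (negPf aj) mul0r.
rewrite det_mulmx; congr (_ * _).
rewrite (expand_det_col _ i) (bigD1 i) //= big1 ?addr0 => [|j ji]; last first.
  by rewrite mxE (negPf ji) mul0r.
rewrite mxE eqxx /cofactor -signr_odd addnn odd_double mul1r.
rewrite (_ : row' i (col' i E) = 1%:M) ?det1 ?mulr1 //.
apply/matrixP => a c; rewrite !mxE eq_sym (negPf (neq_lift _ _)).
by rewrite (inj_eq (@lift_inj _ _)).
Qed.

(* Among the bases of finite-index sublattices, one of minimal determinant
   generates [Lam]: a vector with a fractional coordinate would shrink it. *)
Lemma lattice_basis_exists :
  exists2 V : 'M[R]_k, V \in unitmx & forall x,
    Lam x <-> exists c : 'rV[int]_k, x = zr c *m V.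
Proof.
set N := (M.+1 ^ k)`!.
have N0 : 0 < N%:R :> R by rewrite ltr0n fact_gt0.
(* Clearing denominators by [N] turns [|det V|], up to the fixed factor [|det W| / N ^ k], into a
   natural number; this is why a minimum exists. *)
pose P a := (0 < a)%N && `[< exists V : 'M[R]_k, (forall i, Lam (row i V)) /\
  exists A : 'M[int]_k, V *+ N = zr A *m W /\ `|\det A|%N = a >].
have exA V : (forall i, Lam (row i V)) -> exists A : 'M[int]_k, V *+ N = zr A *m W.
  move=> LV.
  have /choice[c cP] : forall i, exists c : 'rV[int]_k, row i V *+ N = zr c *m W.
    by move=> i; apply: multiple_in_sublattice.
  exists (\matrix_i c i); apply/row_matrixP => i.
  rewrite row_mul -map_row rowK -cP.
  by apply/rowP => j; rewrite mxE !mulmxnE mxE.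
have detA V (A : 'M[int]_k) : V *+ N = zr A *m W ->
    N%:R ^+ k * \det V = (\det A)%:~R * \det W.
  by move=> VA; rewrite -detZ scaler_nat VA det_mulmx det_map_mx.
have detW : \det W != 0 by rewrite -unitfE -unitmxE.
have exP : exists a, P a.
  have [A AP] := exA W LamW; exists `|\det A|%N; rewrite /P absz_gt0; apply/andP; split.
    apply/eqP => A0; have := detA _ _ AP; rewrite A0 mul0r => /eqP.
    by rewrite mulf_eq0 (negPf detW) orbF expf_eq0 (gt_eqF N0) andbF.
  by apply/asboolP; exists W; split => //; exists A.
case: (ex_minnP exP) => a /andP[a0 /asboolP[V [LV [A [VA Aa]]]]] amin.
have detV : \det V != 0.
  apply/eqP => V0; have := detA _ _ VA; rewrite V0 mulr0 => /esym/eqP.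
  rewrite mulf_eq0 (negPf detW) orbF intr_eq0 => /eqP A0.
  by rewrite -Aa A0 absz0 in a0.
have uV : V \in unitmx by rewrite unitmxE unitfE.
exists V => // x; split => [Lx|[c ->]]; last exact: subgroup_comb.
pose s := x *m invmx V.
exists (floorrow s).
suff fr0 : fracrow s = 0 by rewrite -[zr _]addr0 -fr0 -floor_frac mulmxKV.
apply/rowP => i; rewrite [RHS]mxE; apply/eqP; apply: contraT => fi0.
have /andP[fge flt] := fracrow_itv s i.
pose V' : 'M[R]_k := \matrix_(j, l) (if j == i then (fracrow s *m V) ord0 l else V j l).
have LV' j : Lam (row j V').
  case: (eqVneq j i) => [->|ji].
    have -> : row i V' = x - zr (floorrow s) *m V.
      have -> : x = s *m V by rewrite mulmxKV.
      have -> : s *m V = zr (floorrow s) *m V + fracrow s *m V.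
        by rewrite -mulmxDl -floor_frac.
      rewrite addrC addKr.
      by apply/rowP => l; rewrite [LHS]mxE [LHS]mxE eqxx.
    by apply: LamB => //; apply: subgroup_comb.
  suff -> : row j V' = row j V by [].
  by apply/rowP => l; rewrite !mxE (negPf ji).
have [A' VA'] := exA _ LV'.
have detA' : (\det A')%:~R = fracrow s ord0 i * (\det A)%:~R :> R.
  apply: (mulIf detW); rewrite -(detA _ _ VA') -mulrA -(detA _ _ VA).
  by rewrite det_replace_row mulrCA.
have absE (c : int) : `|c|%N%:R = `|c%:~R| :> R.
  by rewrite -intr_norm pmulrn abszE.
have lt : (`|\det A'| < a)%N.
  rewrite -(ltr_nat R) absE detA' normrM (ger0_norm fge) -Aa -absE.
  by rewrite gtr_pMl // ltr0n Aa.
have : P `|\det A'|%N.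
  rewrite /P -(ltr_nat R) absE detA' normrM mulr_gt0 ?normr_gt0 //=; last first.
    by rewrite intr_eq0 -absz_eq0 Aa -lt0n.
  by apply/asboolP; exists V'; split => //; exists A'.
by move=> /amin; rewrite leqNgt lt.
Qed.

Lemma smith_det (A : 'M[int]_k) : exists (L Q : 'M[int]_k) (d : 'rV[int]_k),
  [/\ Q \in unitmx, A = L *m diag_mx d *m Q &
      `|\det A|%N = (\prod_i `|d ord0 i|)%N].
Proof.
have [L uL [Q uQ [d _ AE]]] := int_Smith_normal_form A.
have DE : \matrix_(i < k, j < k) (d`_i *+ (i == j :> nat)) = diag_mx (\row_i d`_i).
  by apply/matrixP => i j; rewrite !mxE.
exists L, Q, (\row_i d`_i); split => //; first by rewrite -DE.
rewrite AE DE !det_mulmx det_diag !abszM.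
have abs1 (U : 'M[int]_k) : U \in unitmx -> `|\det U|%N = 1%N.
  rewrite unitmxE => /orP[/eqP->|/eqP->] //.
rewrite !abs1 // mul1n muln1.
by elim/big_rec2 : _ => [//|i a c _ <-]; rewrite abszM.
Qed.

(** Write [W = A V] and [A = L D Q] in Smith form. The vectors [t Q V] with [0 <= t_i < |d_i|] are
    pairwise incongruent modulo [W], because a congruence makes [t_i - t'_i] a multiple of [d_i].
    There are [|det A|] of them, and [card_incongruent] bounds their number. *)
Lemma covolume_ge V : V \in unitmx ->
  (forall x, Lam x <-> exists c : 'rV[int]_k, x = zr c *m V) ->
  `|\det W| <= (M.+1 ^ k)%:R * `|\det V|.
Proof.
move=> uV VP.
have /choice[c cP] : forall i, exists c : 'rV[int]_k, row i W = zr c *m V.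
  by move=> i; apply/VP.
pose A : 'M[int]_k := \matrix_i c i.
have WA : W = zr A *m V.
  by apply/row_matrixP => i; rewrite row_mul -map_row rowK -cP.
have [L [Q [d [uQ AE dE]]]] := smith_det A.
rewrite WA det_mulmx normrM det_map_mx ler_wpM2r //.
rewrite -intr_norm -abszE -pmulrn ler_nat dE.
pose T := {dffun forall i : 'I_k, 'I_(`|d ord0 i|%N)}.
have -> : (\prod_i `|d ord0 i|)%N = #|T|.
  rewrite card_dep_ffun foldrE big_map big_enum /=.
  by apply: eq_bigr => i _; rewrite card_ord.
pose e (t : T) : 'rV[int]_k := \row_i (t i : nat)%:Z.
have uQR : zr Q \in unitmx by rewrite unitmxE det_map_mx rmorph_unit // -unitmxE.
apply: (@card_incongruent T (fun t => zr (e t) *m (zr Q *m V))).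
  by move=> t; apply/VP; exists (e t *m Q); rewrite map_mxM mulmxA.
move=> t t' [a ta].
have et : e t - e t' = a *m L *m diag_mx d.
  apply: map_intr_inj.
  have uQV : zr Q *m V \in unitmx by rewrite unitmx_mul uQR.
  apply: (can_inj (mulmxK uQV)).
  rewrite map_mxB mulmxBl ta WA AE !map_mxM !mulmxA //.
apply/ffunP => i; apply: val_inj.
have := congr1 (fun m : 'rV[int]_k => m ord0 i) et.
rewrite !mxE (bigD1 i) //= big1 ?addr0 => [|j ji]; last first.
  by rewrite !mxE (negPf ji) mulr0n mulr0.
rewrite [X in _ * X]mxE eqxx mulr1n; move: (X in _ = X * _) => u eu.
have ti := ltn_ord (t i); have ti' := ltn_ord (t' i).
have [u0|u0] := eqVneq u 0.
  by move: eu; rewrite u0 mul0r => /eqP; rewrite subr_eq0 => /eqP[].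
have : (`|d ord0 i| <= `|(t i)%:Z - (t' i)%:Z|)%N.
  by rewrite eu abszM leq_pmull // absz_gt0.
move: ti ti' => /=; lia.
Qed.

End Separated.
End Lattices.

(** * Integer matrices and stabilisers *)

Section IntegerMatrices.
Variable R : realType.
Variable n : nat.
Implicit Types M N : 'M[R]_n.

Lemma intmxP M : is_intmx M <-> exists A : 'M[int]_n, M = map_mx intr A.
Proof.
split=> [iM|[A ->] i j]; last by rewrite mxE intr_int.
exists (\matrix_(i, j) Num.floor (M i j)).
by apply/matrixP => i j; rewrite !mxE floorK // iM.
Qed.

Lemma intmx1 : is_intmx (1%:M : 'M[R]_n).
Proof. by apply/intmxP; exists 1%:M; rewrite map_mx1. Qed.

Lemma intmxM M N : is_intmx M -> is_intmx N -> is_intmx (M *m N).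
Proof. by move=> iM iN i j; rewrite mxE; apply: rpred_sum => l _; apply: rpredM. Qed.

Lemma intmxD M N : is_intmx M -> is_intmx N -> is_intmx (M + N).
Proof. by move=> iM iN i j; rewrite mxE; apply: rpredD. Qed.

Lemma intmxB M N : is_intmx M -> is_intmx N -> is_intmx (M - N).
Proof. by move=> iM iN i j; rewrite !mxE; apply: rpredB. Qed.

Lemma intmxZ (c : R) M : c \is a Num.int -> is_intmx M -> is_intmx (c *: M).
Proof. by move=> ic iM i j; rewrite mxE; apply: rpredM. Qed.

Lemma intmx_det M : is_intmx M -> \det M \is a Num.int.
Proof. by move=> /intmxP[A ->]; rewrite det_map_mx intr_int. Qed.

Lemma intmx_tr M : is_intmx M -> \tr M \is a Num.int.
Proof. by move=> iM; apply: rpred_sum. Qed.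

Lemma int_norm_ge1 (x : R) : x \is a Num.int -> x != 0 -> 1 <= `|x|.
Proof. by move=> /intrP[c ->]; rewrite intr_eq0 -intr_norm ler1z => c0; lia. Qed.

Lemma int_lt1 (x : R) : x \is a Num.int -> `|x| < 1 -> x = 0.
Proof.
move=> ix x1; apply/eqP; apply: contraTT x1 => x0.
by rewrite -leNgt int_norm_ge1.
Qed.

Lemma GLZ_unit M : GLZ M -> M \in unitmx.
Proof. by move=> [_ d1]; rewrite unitmxE unitfE -normr_gt0 d1. Qed.

Lemma GLZ1 : GLZ (1%:M : 'M[R]_n).
Proof. by split; [exact: intmx1|rewrite det1 normr1]. Qed.

Lemma GLZM M N : GLZ M -> GLZ N -> GLZ (M *m N).
Proof.
by move=> [iM dM] [iN dN]; split; [exact: intmxM|rewrite det_mulmx normrM dM dN mulr1].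
Qed.

Lemma GLZV M : GLZ M -> GLZ (invmx M).
Proof.
move=> [iM dM]; have uM : M \in unitmx by apply: GLZ_unit.
split; last by rewrite det_inv normfV dM invr1.
rewrite /invmx uM; apply: intmxZ.
  have /intrP[c cE] := intmx_det iM.
  move: dM => /eqP; rewrite eqr_norml => /andP[/orP[/eqP->|/eqP->] _].
    by rewrite invr1 rpred1.
  by rewrite invrN invr1 rpredN rpred1.
move/intmxP: iM => [A ->]; rewrite -map_mx_adj => i j.
by rewrite mxE intr_int.
Qed.

End IntegerMatrices.

(** * Integer matrices diagonalised by a fixed [g] *)

Section Eigenring.
Variable R : realType.
Variable n : nat.
Variable g : 'M[R]_n.
Hypothesis ug : g \in unitmx.
Implicit Types x y : 'rV[R]_n.

Definition mulrow x y : 'rV[R]_n := \row_j (x ord0 j * y ord0 j).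

(** An isomorphism from [R^n] with coordinatewise product onto the algebra [g Diag g^-1]; integer
    matrices in the image play the role of algebraic integers, given by their conjugates. *)
Definition conjd x := g *m diag_mx x *m invmx g.

Lemma conjdM x y : conjd x *m conjd y = conjd (mulrow x y).
Proof. by rewrite /conjd !mulmxA mulmxKV // -[_ *m _ *m diag_mx y]mulmxA mulmx_diag. Qed.

Lemma conjdB x y : conjd x - conjd y = conjd (x - y).
Proof. by rewrite /conjd -mulmxBl -mulmxBr -linearB. Qed.

Lemma conjdD x y : conjd x + conjd y = conjd (x + y).
Proof. by rewrite /conjd -mulmxDl -mulmxDr -linearD. Qed.

Lemma conjdZ (c : R) x : c *: conjd x = conjd (c *: x).
Proof. by rewrite /conjd linearZ /= -scalemxAr -scalemxAl. Qed.

Lemma conjd1 : conjd (const_mx 1) = 1%:M.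
Proof. by rewrite /conjd diag_const_mx mulmx1 mulmxV. Qed.

Lemma det_conjd x : \det (conjd x) = \prod_j x ord0 j.
Proof.
rewrite /conjd !det_mulmx det_inv det_diag mulrAC mulfV ?mul1r //.
by rewrite -unitfE -unitmxE.
Qed.

Lemma tr_conjd x : \tr (conjd x) = \sum_j x ord0 j.
Proof. by rewrite /conjd -mulmxA mxtrace_mulC mulmxKV // mxtrace_diag. Qed.

Lemma conjd_sym x : conjd x *m g = g *m diag_mx x.
Proof. by rewrite /conjd mulmxKV. Qed.

(* [eint x]: [x] is the tuple of eigenvalues, in the order fixed by [g], of an
   integer matrix diagonalised by [g]. *)
Definition eint x := is_intmx (conjd x).

Lemma eintM x y : eint x -> eint y -> eint (mulrow x y).
Proof. by move=> ix iy; rewrite /eint -conjdM; apply: intmxM. Qed.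

Lemma eintB x y : eint x -> eint y -> eint (x - y).
Proof. by move=> ix iy; rewrite /eint -conjdB; apply: intmxB. Qed.

Lemma eintD x y : eint x -> eint y -> eint (x + y).
Proof. by move=> ix iy; rewrite /eint -conjdD; apply: intmxD. Qed.

Lemma eintZ (c : R) x : c \is a Num.int -> eint x -> eint (c *: x).
Proof. by move=> ic ix; rewrite /eint -conjdZ; apply: intmxZ. Qed.

Lemma eint_const (c : R) : c \is a Num.int -> eint (const_mx c).
Proof.
move=> ic; have -> : const_mx c = c *: const_mx 1 :> 'rV[R]_n.
  by apply/rowP => j; rewrite !mxE mulr1.
by apply: eintZ => //; rewrite /eint conjd1; exact: intmx1.
Qed.

Lemma eint_exp x i : eint x -> eint (\row_j (x ord0 j ^+ i)).
Proof.
move=> ix; elim: i => [|i IH].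
  have -> : \row_j (x ord0 j ^+ 0) = const_mx 1 :> 'rV[R]_n.
    by apply/rowP => j; rewrite !mxE expr0.
  exact: eint_const.
have -> : \row_j (x ord0 j ^+ i.+1) = mulrow x (\row_j (x ord0 j ^+ i)).
  by apply/rowP => j; rewrite !mxE exprS.
exact: eintM.
Qed.

Lemma eint_prod (I : finType) (P : pred I) (f : I -> 'rV[R]_n) :
  (forall i, eint (f i)) -> eint (\row_j \prod_(i | P i) f i ord0 j).
Proof.
move=> ef; suff H (s : seq I) : eint (\row_j \prod_(i <- s | P i) f i ord0 j) by apply: H.
elim: s => [|a s IH].
  have -> : \row_j \prod_(i <- [::] | P i) f i ord0 j = const_mx 1.
    by apply/rowP => j; rewrite !mxE big_nil.
  exact: eint_const.
case Pa: (P a).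
  have -> : \row_j \prod_(i <- a :: s | P i) f i ord0 j =
     mulrow (f a) (\row_j \prod_(i <- s | P i) f i ord0 j).
    by apply/rowP => j; rewrite !mxE big_cons Pa.
  exact: eintM.
have -> // : \row_j \prod_(i <- a :: s | P i) f i ord0 j =
     (\row_j \prod_(i <- s | P i) f i ord0 j).
by apply/rowP => j; rewrite !mxE big_cons Pa.
Qed.

Lemma eint_sum (I : finType) (f : I -> 'rV[R]_n) :
  (forall i, eint (f i)) -> eint (\sum_i f i).
Proof.
move=> ef; apply: big_ind => // [|x y]; last exact: eintD.
have -> : 0 = const_mx 0 :> 'rV[R]_n by apply/rowP => j; rewrite !mxE.
by apply: eint_const; rewrite rpred0.
Qed.

Lemma eint_norm_ge1 x : eint x -> (forall j, x ord0 j != 0) ->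
  1 <= `|\prod_j x ord0 j|.
Proof.
move=> ix x0; rewrite -det_conjd; apply: int_norm_ge1; first exact: intmx_det.
by rewrite det_conjd; apply/prodf_neq0 => j _.
Qed.

(** The sum of squares is the trace of the square of an integer matrix, hence an integer. *)
Lemma eint_small x : eint x -> \sum_j x ord0 j ^+ 2 < 1 -> x = 0.
Proof.
move=> ix x1.
have s0 : 0 <= \sum_j x ord0 j ^+ 2 by apply: sumr_ge0 => j _; exact: sqr_ge0.
have : \sum_j x ord0 j ^+ 2 = 0.
  apply: int_lt1; last by rewrite ger0_norm.
  have := intmx_tr (eintM ix ix); rewrite tr_conjd.
  by under eq_bigr do rewrite mxE -expr2.
move=> /eqP; rewrite psumr_eq0 => [/allP xj|j _]; last exact: sqr_ge0.
apply/rowP => j; rewrite mxE; apply/eqP.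
by have := xj j (mem_index_enum _); rewrite sqrf_eq0.
Qed.

Lemma inGammaR_conjd x : inGammaR (conjd x) <->
  exists2 l : R, l != 0 & eint (l^-1 *: x) /\ `|\prod_j (l^-1 * x ord0 j)| = 1.
Proof.
have E l : \prod_j (l^-1 * x ord0 j) = \det (conjd (l^-1 *: x)).
  by rewrite det_conjd; apply: eq_bigr => j _; rewrite mxE.
split=> [[l [c [l0 [[ic dc] xE]]]]|[l l0 [ex dx]]].
  exists l => //; have cE : conjd (l^-1 *: x) = c.
    by rewrite -conjdZ xE scalerA mulVf // scale1r.
  by rewrite E /eint cE.
exists l, (conjd (l^-1 *: x)); split=> //; split; first by split; rewrite // -E.
by rewrite conjdZ scalerA mulfV // scale1r.
Qed.

End Eigenring.

(** * The stabiliser of a point in the group of the [a(t)] *)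

Section Stabiliser.
Variable R : realType.
Variable k : nat.
Local Notation n := k.+1.
Variable g : 'M[R]_n.
Hypothesis ug : g \in unitmx.
Implicit Types t : 'rV[R]_k.

Definition arow t : 'rV[R]_n :=
  \row_j (if (insub (val j) : option 'I_k) is Some i then expR (t ord0 i) else 1).

Definition srow (e : {ffun 'I_k -> bool}) : 'rV[R]_n :=
  \row_j (if (insub (val j) : option 'I_k) is Some i then (if e i then -1 else 1) else 1).

Lemma a_mxE t : @a_mx R n t = diag_mx (arow t).
Proof. by apply/matrixP => i j; rewrite !mxE; case: eqP. Qed.

Lemma sgn_mxE e : @sgn_mx R n e = diag_mx (srow e).
Proof. by apply/matrixP => i j; rewrite !mxE; case: eqP. Qed.

Lemma arow_lift t i : arow t ord0 (lift ord_max i) = expR (t ord0 i).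
Proof.
have vE : val (lift (@ord_max k) i) = i by rewrite /= /bump leqNgt ltn_ord.
rewrite mxE vE; case: insubP => [u _ /= uE|]; last by rewrite ltn_ord.
by congr (expR (t _ _)); apply: val_inj.
Qed.

Lemma arow_max t : arow t ord0 ord_max = 1.
Proof. by rewrite mxE; case: insubP => //= u; rewrite ltnn. Qed.

Lemma arow_gt0 t j : 0 < arow t ord0 j.
Proof. by case: (unliftP ord_max j) => [i|] ->; rewrite ?arow_max // arow_lift expR_gt0. Qed.

Lemma arowD t t' : arow (t + t') = mulrow (arow t) (arow t').
Proof.
apply/rowP => j; rewrite [RHS]mxE.
case: (unliftP ord_max j) => [i|] ->; rewrite ?arow_max ?mulr1 //.
by rewrite !arow_lift mxE expRD.
Qed.

Lemma arow0 : arow 0 = const_mx 1.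
Proof.
apply/rowP => j; rewrite [RHS]mxE.
by case: (unliftP ord_max j) => [i|] ->; rewrite ?arow_max // arow_lift mxE expR0.
Qed.

Lemma stab_vecE t : stab_vec g t <-> inGammaR (conjd g (arow t)).
Proof. by rewrite /stab_vec a_mxE. Qed.

Lemma inGammaRM (M N : 'M[R]_n) : inGammaR M -> inGammaR N -> inGammaR (M *m N).
Proof.
move=> [l [c [l0 [cG ->]]]] [l' [c' [l'0 [cG' ->]]]].
exists (l * l'), (c *m c'); rewrite mulf_neq0 //; split => //; split; first exact: GLZM.
by rewrite -scalemxAr -scalemxAl scalerA mulrC.
Qed.

Lemma inGammaRV (M : 'M[R]_n) : inGammaR M -> inGammaR (invmx M).
Proof.
move=> [l [c [l0 [cG ->]]]]; exists l^-1, (invmx c).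
rewrite invr_neq0 //; split=> //; split; first exact: GLZV.
by rewrite invmxZ ?unitmxZ ?unitfE // ?(GLZ_unit cG).
Qed.

Lemma inGammaR1 : inGammaR (1%:M : 'M[R]_n).
Proof. by exists 1, 1%:M; rewrite oner_neq0 scale1r; split=> //; split=> //; exact: GLZ1. Qed.

Lemma stab_vec0 : stab_vec g (0 : 'rV[R]_k).
Proof. by apply/stab_vecE; rewrite arow0 conjd1 //; exact: inGammaR1. Qed.

Lemma stab_vecB t t' : stab_vec g t -> stab_vec g t' -> stab_vec g (t - t').
Proof.
move=> /stab_vecE h /stab_vecE h'; apply/stab_vecE.
suff -> : conjd g (arow (t - t')) = conjd g (arow t) *m invmx (conjd g (arow t')).
  by apply: inGammaRM => //; apply: inGammaRV.
have u' : conjd g (arow t') \in unitmx.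
  rewrite unitmxE det_conjd // unitfE; apply/prodf_neq0 => j _.
  by rewrite gt_eqF // arow_gt0.
apply: (can_inj (mulmxK u')); rewrite mulmxKV // conjdM // -arowD subrK //.
Qed.

Lemma prod_arow t : \prod_j arow t ord0 j = expR (\sum_i t ord0 i).
Proof.
rewrite big_ord_recr /= arow_max mulr1 expR_sum; apply: eq_bigr => i _.
rewrite -arow_lift; congr (arow t _ _); apply: val_inj => /=.
by rewrite /bump leqNgt ltn_ord.
Qed.

(* For [t] in the stabiliser and small, a unit with eigenvalues close to
   [+1] or close to [-1] must be [+1] or [-1]. *)
Lemma stab_vec_sep t : stab_vec g t ->
  (forall i, `|t ord0 i| < (8 * n%:R)^-1) -> t = 0.
Proof.
move=> /stab_vecE /inGammaR_conjd - /(_ ug) [l l0 [el pl]] ts.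
set r := (8 * n%:R)^-1 in ts.
have n0 : 0 < n%:R :> R by rewrite ltr0n.
have r0 : 0 < r by rewrite invr_gt0 mulr_gt0.
have tsum : `|\sum_i t ord0 i| <= n%:R * r.
  apply: le_trans (ler_norm_sum _ _ _) _.
  apply: le_trans (ler_sum _ (G := fun _ => r) _) _; first by move=> i _; exact: ltW.
  by rewrite sumr_const card_ord -[leLHS]mulr_natl ler_wpM2r ?ler_nat // ltW.
have l'0 : 0 < `|l| by rewrite normr_gt0.
(* The unit determinant fixes [|l|] as the geometric mean of the eigenvalues, so that [ln |l|] is as
   small as [t]. The sign of [l] is then split off as [sg]. *)
have lE : `|l| ^+ n = expR (\sum_i t ord0 i).
  move: pl; rewrite big_split /= prodr_const card_ord prod_arow normrM.
  rewrite [`|expR _|]gtr0_norm ?expR_gt0 // normrX normfV exprVn => /eqP.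
  by rewrite mulrC -(can_eq (mulfK (expf_neq0 n (lt0r_neq0 l'0)))) divfK ?mul1r
     ?expf_neq0 ?lt0r_neq0 // => /eqP.
have lnl : `|ln `|l| | <= r.
  have E : n%:R * ln `|l| = \sum_i t ord0 i.
    by rewrite -[RHS](expRK) -lE lnXn // mulr_natl.
  rewrite -(ler_pM2l n0) -{1}[n%:R](gtr0_norm n0) -normrM E //.
have [sg [sg1 lsg]] : exists sg : R, (sg = 1 \/ sg = -1) /\ l = sg * `|l|.
  have [lp|lp] := ltP 0 l; first by exists 1; split; [left|rewrite mul1r gtr0_norm].
  by exists (-1); split; [right|rewrite ler0_norm // mulN1r opprK].
have sgsg : sg * sg = 1 by case: sg1 => ->; rewrite ?mulr1 // mulrNN mulr1.
pose x : 'rV[R]_n := sg *: (l^-1 *: arow t) - const_mx 1.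
have ex : eint g x.
  apply: eintB; last by apply: eint_const => //; rewrite rpred1.
  apply: eintZ => //.
  by case: sg1 => ->; rewrite ?rpredN rpred1.
have arow_exp j : exists2 s, `|s| <= r & arow t ord0 j = expR s.
  case: (unliftP ord_max j) => [i|] ->.
    by exists (t ord0 i); [exact: ltW|rewrite arow_lift].
  by exists 0; rewrite ?normr0 ?ltW // arow_max expR0.
have xE j : x ord0 j = arow t ord0 j / `|l| - 1.
  rewrite !mxE {1}lsg invfM mulrA; congr (_ - 1).
  rewrite [RHS]mulrC; congr (_ * _); rewrite mulrA (_ : sg / sg = 1) ?mul1r //.
  by case: sg1 => ->; rewrite ?invrN invr1 ?mulrNN mulr1.
(* Since [|z| <= 2 r <= 1/4], one has [|exp z - 1| <= 2 |z|]. With [r = 1 / (8 n)] the sum of the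
   [n] squares is at most [1 / (4 n) < 1], which is what [eint_small] needs. *)
have xs j : `|x ord0 j| <= 4 * r.
  have [s sr sE] := arow_exp j.
  rewrite xE sE -{1}[`|l|]lnK ?posrE // -expRN -expRD.
  set z := s - _.
  have zr : `|z| <= 2 * r by apply: le_trans (ler_normB _ _) _; rewrite mulr2n mulrDl mul1r lerD.
  have r8 : r <= 8^-1.
    by rewrite /r invfM ger_pMr ?invr_gt0 // invf_le1 // ler1n.
  have e1 := expR_ge1Dx z; have e2 := expR_ge1Dx (- z).
  move: zr; rewrite ler_norml => /andP[z1 z2].
  have ez : expR z * expR (- z) = 1 by rewrite -expRD subrr expR0.
  have ez0 := expR_gt0 z.
  by rewrite ler_norml; apply/andP; split; nra.
have x0 : x = 0.
  apply: (eint_small ug ex).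
  apply: le_lt_trans (ler_sum _ (G := fun _ => (4 * r) ^+ 2) _) _.
    by move=> j _; rewrite -real_normK ?num_real // lerXn2r ?nnegrE // mulr_ge0 // ltW.
  rewrite sumr_const card_ord -[X in X < 1]mulr_natr.
  have -> : 4 * r = (2 * n%:R)^-1 by rewrite /r; field; rewrite lt0r_neq0.
  have n1 : 1 <= n%:R :> R by rewrite ler1n.
  rewrite exprVn mulrC ltr_pdivrMr ?exprn_gt0 ?mulr_gt0 // mul1r; nra.
have aE j : arow t ord0 j = `|l|.
  have /eqP := xE j; rewrite x0 mxE eq_sym subr_eq0 => /eqP E.
  by rewrite -[LHS](divfK (lt0r_neq0 l'0)) E mul1r.
apply/rowP => i; rewrite mxE; apply: (@expR_inj R).
by rewrite -arow_lift aE -(aE ord_max) arow_max expR0.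
Qed.

End Stabiliser.

(** * The polynomials and their roots *)

Section Roots.
Variable R : realType.
Variables k m : nat.
Local Notation n := k.+1.
Hypothesis k_gt0 : (0 < k)%N.
Hypothesis m_ge6 : (6 <= m)%N.

Local Notation mR := (m%:R : R).
Definition node (i : 'I_n) : R := (i * m)%:R.

Lemma node_dist (i j : 'I_n) : i != j -> mR <= `|node j - node i|.
Proof.
move=> ij; wlog lt : i j ij / (i < j)%N.
  move=> wl; case: (ltngtP i j) => [|lt|/val_inj eq]; first exact: wl.
    by rewrite distrC; apply: wl => //; rewrite eq_sym.
  by rewrite eq eqxx in ij.
rewrite /node -natrB ?leq_mul2r ?(ltnW lt) ?orbT // -mulnBl normr_nat ler_nat.
by rewrite leq_pmull // subn_gt0.
Qed.

Lemma node_dist_le (i j : 'I_n) : `|node j - node i| <= k%:R * mR.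
Proof.
have H (a : 'I_n) : 0 <= node a <= k%:R * mR.
  by rewrite /node ler0n -natrM ler_nat leq_mul2r -ltnS ltn_ord orbT.
have /andP[j0 jk] := H j; have /andP[i0 ik] := H i.
by rewrite ler_norml; apply/andP; split; lra.
Qed.

(** Intermediate value theorem. At [node j + s] the product is [s h(s)]. For [s = 1/5] and
    [s = -1/5] the other factors exceed 5 in absolute value, as [m >= 6], and [h] has the same sign
    at both points; so the product is above 1 at one end and below -1 at the other. *)
Lemma root_near (j : 'I_n) : exists2 x : R, `|x - node j| <= 5^-1 &
  \prod_(i < n) (x - node i) = 1.
Proof.
have m6 : 6 <= mR by rewrite ler_nat.
pose h (s : R) := \prod_(i < n | i != j) (node j + s - node i).
have hE s : \prod_(i < n) (node j + s - node i) = s * h s.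
  by rewrite (bigD1 j) //= addrAC subrr add0r.
have dist i (s : R) : i != j -> `|s| <= 5^-1 -> 5 < `|node j + s - node i|.
  move=> ij sj; have := node_dist ij.
  have := ler_normB (node j + s - node i) s.
  rewrite (_ : node j + s - node i - s = node j - node i); last by ring.
  by lra.
have hbig s : `|s| <= 5^-1 -> 5 < `|h s|.
  move=> s4; pose i0 : 'I_n := if j == ord0 then ord_max else ord0.
  have i0j : i0 != j.
    rewrite /i0; case: ifP => [/eqP ->|/negbT]; last by rewrite eq_sym.
    by rewrite -val_eqE /= -lt0n.
  rewrite /h (bigD1 i0) //= normrM.
  apply: (lt_le_trans (dist i0 s i0j s4)).
  rewrite ler_peMr // normr_prod.
  apply: (big_ind (fun x : R => 1 <= x)) => // [a b a1 b1|i /andP[ij _]].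
    exact: mulr_ege1.
  by apply: ltW; apply: lt_trans (dist i s ij s4); rewrite ltr1n.
have q5 : `|5^-1 : R| <= 5^-1 by rewrite ger0_norm ?invr_ge0.
have q5' : `|- 5^-1 : R| <= 5^-1 by rewrite normrN.
have hsign : 0 < h 5^-1 * h (- 5^-1).
  rewrite /h -big_split /= prodr_gt0 // => i ij.
  have := node_dist (i := i) (j := j) ij.
  have -> : (node j + 5^-1 - node i) * (node j + - 5^-1 - node i) =
     (node j - node i) ^+ 2 - 25^-1 by field.
  rewrite -[(_ - _) ^+ 2]real_normK ?num_real //.
  set d := `|_| => dm; nra.
pose p : {poly R} := \prod_(i < n) ('X - (node i)%:P) - 1.
have pE x : p.[x] = \prod_(i < n) (x - node i) - 1.
  by rewrite /p !hornerE horner_prod; congr (_ - 1); apply: eq_bigr => i _; rewrite !hornerE.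
have le : node j - 5^-1 <= node j + 5^-1 by lra.
have b1 := hbig _ q5; have b2 := hbig _ q5'.
have p1 : p.[node j + 5^-1] = 5^-1 * h 5^-1 - 1 by rewrite pE hE.
have p2 : p.[node j - 5^-1] = - 5^-1 * h (- 5^-1) - 1 by rewrite pE hE.
have [x xI xr] : exists2 x, node j - 5^-1 <= x <= node j + 5^-1 & root p x.
  have [h0|h0] := ltP 0 (h 5^-1).
    have h0' : 0 < h (- 5^-1) by move: hsign; rewrite pmulr_rgt0.
    rewrite gtr0_norm // in b1; rewrite gtr0_norm // in b2.
    apply: poly_ivt => //; rewrite p1 p2; apply/andP; split; lra.
  have h1 : h 5^-1 < 0.
    by rewrite lt_neqAle h0 andbT; apply/eqP => h10; move: hsign; rewrite h10 mul0r ltxx.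
  have h0' : h (- 5^-1) < 0 by move: hsign; rewrite nmulr_rgt0.
  rewrite ltr0_norm // in b1; rewrite ltr0_norm // in b2.
  have [|x xI xr] := @poly_ivt R (- p) _ _ le.
    by rewrite !hornerN p1 p2; apply/andP; split; lra.
  by exists x => //; rewrite -rootN.
exists x; first by rewrite ler_norml; move: xI => /andP[x1 x2]; apply/andP; split; lra.
by apply/eqP; rewrite -subr_eq0 -pE.
Qed.

(** The coefficients do not depend on the root: they form the last row of the companion matrix. *)
Lemma monic_relation : exists p : 'I_n -> int, forall x : R,
  \prod_(i < n) (x - node i) = 1 -> x ^+ n = \sum_(i < n) (p i)%:~R * x ^+ i.
Proof.
pose Q : {poly int} := \prod_(i < n) ('X - ((i * m)%:Z)%:P).
have sQ : size Q = n.+1 by rewrite /Q size_prod_XsubC /index_enum -enumT size_enum_ord.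
have lQ : Q`_n = 1.
  have : Q \is monic by exact: monic_prod_XsubC.
  by rewrite monicE lead_coefE sQ => /eqP.
exists (fun i => (i == ord0)%:Z - Q`_i) => x xE.
have : (map_poly intr Q).[x] = 1.
  rewrite -[RHS]xE /Q rmorph_prod /= horner_prod; apply: eq_bigr => i _.
  by rewrite rmorphB /= map_polyX map_polyC /= !hornerE /node.
rewrite (@horner_coef_wide _ n.+1) ?size_map_inj_poly ?sQ //; last exact: intr_inj.
rewrite big_ord_recr /= coef_map /= lQ mul1r => xn.
under eq_bigr do rewrite intrB mulrBl.
rewrite sumrB (bigD1 ord0) //= big1 => [|i /negPf ->]; last by rewrite mul0r.
apply/eqP; rewrite addr0 expr0 mulr1 eq_sym subr_eq -[X in X == _]xn addrC.
by under eq_bigr do rewrite coef_map.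
Qed.

(* The logarithms of the absolute values of the units [al_j - node i] form a
   matrix close to [ln m] times (all ones minus [n] times the identity). *)
Section Estimates.
Variable al : 'rV[R]_n.
Hypothesis al_node : forall j, `|al ord0 j - node j| <= 5^-1.
Hypothesis al_prod : forall j, \prod_(i < n) (al ord0 j - node i) = 1.

Definition logu (i j : 'I_n) : R := ln `|al ord0 j - node i|.

Lemma al_sub_node i j : i != j ->
  mR / 2 <= `|al ord0 j - node i| <= n%:R * mR.
Proof.
move=> ij; have m6 : 6 <= mR by rewrite ler_nat.
have d1 := node_dist ij; have d2 := node_dist_le i j; have a := al_node j.
have := ler_normD (al ord0 j - node j) (node j - node i).
have := ler_normB (al ord0 j - node i) (al ord0 j - node j).
rewrite (_ : al ord0 j - node i - _ = node j - node i); last by ring.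
rewrite (_ : al ord0 j - node j + _ = al ord0 j - node i); last by ring.
have -> : n%:R = k%:R + 1 :> R by rewrite natr1.
rewrite mulrDl mul1r; move: (`|_|) (`|_|) (`|_|) d1 d2 a => x y z.
by move=> *; apply/andP; split; lra.
Qed.

Lemma al_sub_al i j : i != j -> mR / 2 <= `|al ord0 j - al ord0 i|.
Proof.
move=> ij; have m6 : 6 <= mR by rewrite ler_nat.
have d1 := node_dist ij; have a := al_node j; have a' := al_node i.
have := ler_normD (al ord0 j - al ord0 i) (al ord0 i - node i - (al ord0 j - node j)).
have := ler_normB (al ord0 i - node i) (al ord0 j - node j).
rewrite (_ : al ord0 j - al ord0 i + _ = node j - node i); last by ring.
lra.
Qed.

Lemma al_inj i j : al ord0 i = al ord0 j -> i = j.
Proof.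
move=> E; apply/eqP; apply: contraT => ij; have := al_sub_al ij.
by rewrite E subrr normr0 pmulr_lle0 ?invr_gt0 // lern0; case: m m_ge6.
Qed.

Lemma al_unit i j : al ord0 j - node i != 0.
Proof.
by have /eqP := al_prod j; apply: contraTneq => E; rewrite (bigD1 i) //= E mul0r eq_sym oner_neq0.
Qed.

Lemma al_le j : `|al ord0 j| <= n%:R * mR.
Proof.
have m6 : 6 <= mR by rewrite ler_nat.
have n0 : node (ord0 : 'I_n) = 0 by rewrite /node mul0n.
have := al_node j; have := node_dist_le ord0 j; rewrite n0 subr0.
have := ler_normD (al ord0 j - node j) (node j); rewrite subrK.
by rewrite -[n%:R]natr1 mulrDl mul1r; lra.
Qed.

Local Notation c := (ln (2 * n%:R) : R).

Lemma ln2n_ge0 : 0 <= c.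
Proof. by apply: ln_ge0; rewrite -natrM ler1n. Qed.

Lemma lnm_ge0 : 0 <= ln mR.
Proof. by apply: ln_ge0; rewrite ler1n; case: m m_ge6. Qed.

(** The distance from [al_j] to another node lies between [m / 2] and [n m], hence within a factor
    [2 n] of [m]. *)
Lemma logu_off i j : i != j -> `|logu i j - ln mR| <= c.
Proof.
move=> ij; have /andP[l1 l2] := al_sub_node ij.
have m0 : 0 < mR by rewrite ltr0n; case: m m_ge6.
have n1 : 1 <= n%:R :> R by rewrite ler1n.
have u0 : 0 < `|al ord0 j - node i| by rewrite normr_gt0 al_unit.
rewrite ler_norml lerBlDr lerBrDr; apply/andP; split.
  rewrite addrC lerBlDr /logu -lnM ?posrE ?mulr_gt0 // ler_ln ?posrE ?mulr_gt0 //.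
  nra.
rewrite /logu -lnM ?posrE ?mulr_gt0 // ler_ln ?posrE ?mulr_gt0 //.
nra.
Qed.

Lemma sum_logu j : \sum_i logu i j = 0.
Proof.
have [_ ->] : 0 < `|\prod_i (al ord0 j - node i)| /\
    \sum_i logu i j = ln `|\prod_i (al ord0 j - node i)|.
  rewrite normr_prod; elim/big_rec2 : _ => [|i x y _ [y0 ->]]; first by rewrite ln1.
  have u0 : 0 < `|al ord0 j - node i| by rewrite normr_gt0 al_unit.
  by rewrite mulr_gt0 // lnM ?posrE.
by rewrite al_prod normr1 ln1.
Qed.

(** The tiny factor [al_j - node j] need not be estimated: the logarithms for a fixed root add up to
    0, which determines the diagonal one from the [k] others. *)
Lemma logu_diag j : `|logu j j + k%:R * ln mR| <= k%:R * c.
Proof.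
have := sum_logu j; rewrite (bigD1 j) //= => /eqP; rewrite addr_eq0 => /eqP ->.
have -> : k%:R * ln mR = \sum_(i < n | i != j) ln mR.
  by rewrite sumr_const cardC1 card_ord mulr_natl.
rewrite addrC -sumrB; apply: le_trans (ler_norm_sum _ _ _) _.
apply: le_trans (ler_sum _ (G := fun _ => c) _) _.
  by move=> i ij; rewrite distrC; apply: logu_off.
by rewrite sumr_const cardC1 card_ord [X in _ <= X]mulr_natl.
Qed.

(** Row [i] is the parameter [t] for the square of a unit, whence the factor 2. The last column is
    subtracted because elements of [PGL_n] are normalised to have last entry 1. *)
Definition logmx : 'M[R]_k :=
  \matrix_(i, j) (2 * (logu (lift ord_max i) (lift ord_max j) - logu (lift ord_max i) ord_max)).

(** The main terms are [2 (- k ln m - ln m) = - 2 n ln m] on the diagonal, and cancel off it. *)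
Lemma logmx_near i j :
  `|logmx i j + (2 * n%:R * ln mR) *+ (i == j)| <= 2 * n%:R * c.
Proof.
have n2 : 2 <= n%:R :> R by rewrite ler_nat.
have n1 : n%:R = k%:R + 1 :> R by rewrite natr1.
have l1 : lift ord_max i != ord_max :> 'I_n by rewrite eq_sym neq_lift.
have o1 := logu_off l1; have c0 := ln2n_ge0.
rewrite mxE; case: (eqVneq i j) => [->|ij]; rewrite ?mulr1n ?mulr0n ?addr0.
  have d1 := logu_diag (lift ord_max j).
  have l2 : lift ord_max j != ord_max :> 'I_n by rewrite eq_sym neq_lift.
  have o2 := logu_off l2.
  have := ler_normB (logu (lift ord_max j) (lift ord_max j) + k%:R * ln mR)
    (logu (lift ord_max j) ord_max - ln mR).
  set A := logu _ _; set B := logu _ _.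
  rewrite -mulrA -mulrDr normrM ger0_norm // => H.
  rewrite -mulrA ler_wpM2l //.
  rewrite (_ : A - B + _ = A + k%:R * ln mR - (B - ln mR)); last by rewrite n1; ring.
  apply: le_trans H _; rewrite {1}n1 mulrDl mul1r; exact: lerD.
have l2 : lift ord_max i != lift ord_max j :> 'I_n by rewrite (inj_eq lift_inj).
have o2 := logu_off l2.
have := ler_normB (logu (lift ord_max i) (lift ord_max j) - ln mR)
    (logu (lift ord_max i) ord_max - ln mR).
rewrite (_ : logu _ _ - ln mR - (logu _ _ - ln mR) =
  logu (lift ord_max i) (lift ord_max j) - logu (lift ord_max i) ord_max); last by ring.
set A := logu _ _; set B := logu _ _ => H.
rewrite normrM ger0_norm // -mulrA ler_wpM2l //.
nra.
Qed.

Lemma logmx_le i j : (2 * n <= m)%N -> `|logmx i j| <= 4 * n%:R * ln mR.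
Proof.
move=> nm; have := logmx_near i j.
have cm : c <= ln mR.
  rewrite -natrM ler_ln ?posrE ?ltr0n ?ler_nat //; exact: leq_trans nm.
have l0 := lnm_ge0; have n1 : 1 <= n%:R :> R by rewrite ler1n.
have := ler_normB (logmx i j + (2 * n%:R * ln mR) *+ (i == j)) ((2 * n%:R * ln mR) *+ (i == j)).
rewrite addrK => H1 H2; apply: le_trans H1 _.
have : `|(2 * n%:R * ln mR) *+ (i == j)| <= 2 * n%:R * ln mR.
  by case: (i == j); rewrite ?mulr1n ?mulr0n ?normr0 ?ger0_norm ?mulr_ge0.
move=> H3; apply: le_trans (lerD H2 H3) _.
have : 2 * n%:R * c <= 2 * n%:R * ln mR by rewrite ler_wpM2l ?mulr_ge0.
lra.
Qed.

End Estimates.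

Lemma det_near1 (R' : realType) k' : exists2 eta : R', 0 < eta & forall E : 'M[R']_k',
  (forall i j, `|E i j - (i == j)%:R| <= eta) -> 2^-1 <= `|\det E|.
Proof.
have := @continuous_det R' k' 1%:M; rewrite /continuous_at det1 => /cvgrPdist_lt.
have h2 : 0 < 2^-1 :> R' by rewrite invr_gt0.
move=> /(_ _ h2) /nbhs_ballP[e /= e0 He].
exists (e / 2) => [|E HE]; first by rewrite divr_gt0.
have : `|1 - \det E| < 2^-1.
  apply: He; split=> // i j; rewrite /ball /= mxE distrC.
  apply: le_lt_trans (HE i j) _; by rewrite ltr_pdivrMr // ltr_pMr // ltr1n.
have := ler_normD (1 - \det E) (\det E); rewrite subrK normr1; lra.
Qed.

End Roots.

(** * Orbits *)

Section Orbits.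
Variable R : realType.
Variable k : nat.
Local Notation n := k.+1.
Implicit Types g : 'M[R]_n.

Lemma Hdiag_row (D : 'M[R]_n) : Hdiag D -> exists2 d : 'rV[R]_n,
  D = diag_mx d & forall j, d ord0 j != 0.
Proof.
move=> [/diag_mxP[d ->]]; rewrite unitmxE unitfE det_diag => /prodf_neq0 dn0.
by exists d => // j; apply: dn0.
Qed.

(* [h |-> h diag(al) h^-1] is continuous, takes integer matrices as values on
   the orbit of [g], and determines the coset [h Hdiag]. *)
Lemma orbit_closed g (al : 'rV[R]_n) : g \in unitmx -> eint g al ->
  (forall i j, al ord0 i = al ord0 j -> i = j) ->
  closure (orbit_set g) `&` GLR (n := n) `<=` orbit_set g.
Proof.
move=> ug eal inj h [clh uh].
pose phi (M : 'M[R]_n) := M *m diag_mx al *m invmx M.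
have cphi : continuous_at h phi.
  apply: continuous_mulmx; last exact: continuous_invmx.
  by apply: continuous_mulmx; [exact: cvg_id|exact: cst_continuous].
have orb h' : orbit_set g h' -> h' \in unitmx /\ is_intmx (phi h').
  move=> [c [D [cG [HD ->]]]]; have uc := GLZ_unit cG; have uD := HD.2.
  split; first by rewrite !unitmx_mul uc ug.
  have [d dE d0] := Hdiag_row HD.
  rewrite /phi (_ : c *m g *m D *m diag_mx al *m invmx (c *m g *m D) =
     c *m conjd g al *m invmx c).
    by apply: intmxM; [apply: intmxM => //; case: cG|case: (GLZV cG)].
  have ucgD : c *m g *m D \in unitmx by rewrite !unitmx_mul uc ug.
  apply: (can_inj (mulmxK ucgD)); rewrite mulmxKV // /conjd !mulmxA.
  rewrite mulmxKV // mulmxKV // -!mulmxA; congr (_ *m (_ *m _)).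
  by rewrite dE !mulmx_diag; congr diag_mx; apply/rowP => j; rewrite !mxE mulrC.
have ap (e : R) : 0 < e -> exists2 h', orbit_set g h' &
    forall i j, `|phi h i j - phi h' i j| < e.
  move=> e0; have : nbhs h [set M | ball (phi h) e (phi M)].
    by apply: cphi; exact: nbhsx_ballx.
  by move=> /clh[h' [oh' [_ H]]]; exists h'.
have q0 : 0 < 4^-1 :> R by rewrite invr_gt0.
have [h' oh' hh'] := ap _ q0.
have [uh' ih'] := orb _ oh'.
(* The limit of integer matrices is attained. If an entry of [phi h'] differed from that of [phi h],
   by less than [1/4], a closer orbit point [h2] would have an integer entry at distance less than 1
   from it, hence equal to it, and so no closer. *)
have E : phi h = phi h'.
  apply/matrixP => i j; apply/eqP; rewrite -subr_eq0 -normr_eq0.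
  apply: contraT => ne0; have d0 : 0 < `|phi h i j - phi h' i j|.
    by rewrite lt_neqAle eq_sym ne0 /=.
  have [h2 oh2 hh2] := ap _ d0.
  have [_ ih2] := orb _ oh2.
  have : phi h2 i j - phi h' i j = 0.
    apply: int_lt1; first by apply: rpredB.
    have := hh2 i j; have := hh' i j.
    have := ler_normB (phi h i j - phi h' i j) (phi h i j - phi h2 i j).
    rewrite (_ : _ - _ - (_ - _) = phi h2 i j - phi h' i j); last by ring.
    lra.
  move=> /eqP; rewrite subr_eq0 => /eqP e2.
  by have := hh2 i j; rewrite e2 ltxx.
(* [F] commutes with [diag(al)], whose entries are distinct, so it is diagonal. *)
pose F := invmx h' *m h.
have comm : diag_mx al *m F = F *m diag_mx al.
  have e1 : h *m diag_mx al = h' *m diag_mx al *m invmx h' *m h.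
    by rewrite -/(phi h') -E /phi mulmxKV.
  by rewrite /F -[RHS]mulmxA e1 !mulmxA mulVmx // mul1mx.
have dF : is_diag_mx F.
  apply/is_diag_mxP => i j ij; have := congr1 (fun M : 'M[R]_n => M i j) comm.
  rewrite /= mul_diag_mx mul_mx_diag !mxE mulrC => /eqP.
  rewrite -subr_eq0 -mulrBr mulf_eq0 => /orP[/eqP //|].
  by rewrite subr_eq0 => /eqP /inj /eqP; rewrite -val_eqE (negPf ij).
have hF : h = h' *m F by rewrite /F mulmxA mulmxV // mul1mx.
case: oh' => c [D [cG [HD h'E]]].
exists c, (D *m F); split=> //; split; last by rewrite mulmxA -h'E -hF.
split; last by rewrite unitmx_mul HD.2 /F unitmx_mul unitmx_inv uh'.
have [d -> _] := Hdiag_row HD; move/diag_mxP: dF => [f ->].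
by rewrite mulmx_diag diag_mx_is_diag.
Qed.

Lemma stab_comb g (W : 'M[R]_k) (c : 'rV[int]_k) : g \in unitmx ->
  (forall i, stab_vec g (row i W)) -> stab_vec g (map_mx intr c *m W).
Proof.
move=> ug LW; apply: (@subgroup_comb R k (fun t => stab_vec g t)) => //.
  exact: stab_vec0.
by move=> x y; apply: stab_vecB.
Qed.

Lemma arow_bound (t : 'rV[R]_k) (tau : R) j : 0 <= tau ->
  (forall i, `|t ord0 i| <= tau) -> expR (- tau) <= arow t ord0 j <= expR tau.
Proof.
move=> tau0 tb; case: (unliftP ord_max j) => [i|] ->.
  by rewrite arow_lift !ler_expR -ler_norml.
by rewrite arow_max -expR0 !ler_expR oppr_le0 tau0.
Qed.

Lemma mx_bounded g : exists2 G : R, 0 <= G & forall i j, `|g i j| <= G.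
Proof.
exists (\sum_i \sum_j `|g i j|); first by apply: sumr_ge0 => i _; apply: sumr_ge0.
move=> i j; rewrite (bigD1 i) //= (bigD1 j) //= -addrA lerDl addr_ge0 ?sumr_ge0 //.
by move=> a _; apply: sumr_ge0.
Qed.

(** Split a diagonal matrix into its last entry [l], the signs [s], and the positive part [a(t)];
    then reduce [t] modulo [W]. The remainder has coordinates at most [tau = k b], which bounds the
    entries from above and the determinant from below. *)
Lemma orbit_cocompact g (W : 'M[R]_k) (b : R) : g \in unitmx -> W \in unitmx -> 0 <= b ->
  (forall i j, `|W i j| <= b) -> (forall i, stab_vec g (row i W)) ->
  exists K : set 'M[R]_n, compact K /\ K `<=` GLR (n := n) /\
    forall D, Hdiag D -> exists (c : 'M[R]_n) (l : R) (k0 : 'M[R]_n),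
        GLZ c /\ l != 0 /\ K k0 /\ g *m D = l *: (c *m k0).
Proof.
move=> ug uW b0 Wb LW.
have [G G0 gG] := mx_bounded g.
pose tau := k%:R * b; have tau0 : 0 <= tau by rewrite mulr_ge0.
have dg : 0 < `|\det g| by rewrite normr_gt0 -unitfE -unitmxE.
have e0 : 0 < `|\det g| * expR (- tau) ^+ n by rewrite mulr_gt0 // exprn_gt0 ?expR_gt0.
exists [set M : 'M[R]_n | (forall i j, `|M i j| <= G * expR tau) /\
   `|\det g| * expR (- tau) ^+ n <= `|\det M|]; split; first exact: compact_box_det.
split=> [M [_ dM]|D HD].
  by rewrite /GLR /= unitmxE unitfE -normr_gt0; apply: lt_le_trans dM.
have [d -> d0] := Hdiag_row HD.
pose l := d ord0 ord_max.
pose t : 'rV[R]_k := \row_i ln `|d ord0 (lift ord_max i) / l|.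
pose s : 'rV[R]_n := \row_j Num.sg (d ord0 j / l).
have dls j : d ord0 j = l * (s ord0 j * arow t ord0 j).
  suff -> : s ord0 j * arow t ord0 j = d ord0 j / l by rewrite mulrC divfK ?d0.
  rewrite [RHS]numEsg mxE; congr (_ * _).
  case: (unliftP ord_max j) => [i|] ->; last by rewrite arow_max /l divff ?d0 // normr1.
  by rewrite arow_lift mxE lnK // posrE normr_gt0 mulf_neq0 ?invr_neq0 ?d0.
pose x := t *m invmx W; pose y := fracrow x *m W.
have tE : t = map_mx intr (floorrow x) *m W + y.
  by rewrite -mulmxDl -floor_frac mulmxKV.
have [l' [c [l'0 [cG cE]]]] : inGammaR (conjd g (arow (map_mx intr (floorrow x) *m W))).
  by apply/stab_vecE; apply: stab_comb.
pose k0 := g *m diag_mx (mulrow s (arow y)).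
exists c, (l * l'), k0; split => //; split; first by rewrite mulf_neq0 ?d0.
have yb j : expR (- tau) <= arow y ord0 j <= expR tau.
  by apply: arow_bound => // i; apply: fracrow_mul_le.
have s1 j : `|s ord0 j| = 1.
  by rewrite mxE normr_sg mulf_neq0 ?invr_neq0 ?d0.
have rb j : `|mulrow s (arow y) ord0 j| = arow y ord0 j.
  by rewrite [X in `|X|]mxE normrM s1 mul1r gtr0_norm ?arow_gt0.
split; [split|].
- move=> i j; rewrite /k0 mul_mx_diag mxE normrM ler_pM // rb.
  by case/andP: (yb j).
- rewrite /k0 det_mulmx normrM ler_wpM2l // det_diag normr_prod.
  rewrite -[X in _ ^+ X](card_ord n) -prodr_const; apply: ler_prod => j _.
  by rewrite rb expR_ge0; case/andP: (yb j).
- have dE : d = l *: mulrow (arow (map_mx intr (floorrow x) *m W)) (mulrow s (arow y)).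
    apply/rowP => j; rewrite dls tE arowD [RHS]mxE; congr (_ * _).
    by rewrite [LHS]mulrC [X in X * _]mxE [RHS]mxE [X in _ = _ * X]mxE; ring.
  rewrite {1}dE linearZ /= -scalemxAr -scalerA; congr (_ *: _).
  by rewrite scalemxAl -cE /k0 mulmxA conjd_sym // -mulmxA mulmx_diag.
Qed.

(* The first row of [g2 = c g1 D] consists of ones, so the inverses of the
   diagonal entries of [D] are the eigenvalues of an integer matrix. *)
Lemma same_orbit_det g1 g2 : g1 \in unitmx ->
  (forall c : 'rV[int]_n, eint g1 (map_mx intr c *m g1)) ->
  (forall j, g2 ord0 j = 1) -> same_orbit g1 g2 -> `|\det g2| <= `|\det g1|.
Proof.
move=> ug1 int1 one2 [c [D [cG [HD g2E]]]].
have [d dE d0] := Hdiag_row HD.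
have [A cA] := (intmxP c).1 cG.1.
have rowc : map_mx intr (row ord0 A) *m g1 = row ord0 (c *m g1).
  by rewrite row_mul cA map_row.
have xd j : (row ord0 (c *m g1)) ord0 j * d ord0 j = 1.
  by rewrite -(one2 j) g2E dE mul_mx_diag !mxE.
have x0 j : (row ord0 (c *m g1)) ord0 j != 0.
  by have /eqP := xd j; apply: contraTneq => ->; rewrite mul0r eq_sym oner_neq0.
have := int1 (row ord0 A); rewrite rowc => /eint_norm_ge1 - /(_ ug1 x0) ge1.
have pd : (\prod_j (row ord0 (c *m g1)) ord0 j) * \prod_j d ord0 j = 1.
  by rewrite -big_split /= big1 // => j _; exact: xd.
have d1 : `|\prod_j d ord0 j| <= 1.
  have := congr1 Num.norm pd; rewrite normrM normr1 => E.
  by rewrite -[leRHS]E ler_peMl.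
rewrite g2E !det_mulmx dE det_diag !normrM cG.2 mul1r.
by rewrite ler_piMr.
Qed.

Lemma same_orbit_sym g1 g2 : same_orbit g1 g2 -> same_orbit g2 g1.
Proof.
move=> [c [D [cG [HD ->]]]]; have uc := GLZ_unit cG.
exists (invmx c), (invmx D); split; first exact: GLZV; split.
  split; last by rewrite unitmx_inv HD.2.
  have [d dE d0] := Hdiag_row HD.
  have -> : invmx D = diag_mx (\row_j (d ord0 j)^-1).
    apply: (can_inj (mulmxK HD.2)); rewrite mulVmx ?HD.2 // dE mulmx_diag.
    rewrite -diag_const_mx; congr diag_mx; apply/rowP => j.
    by rewrite !mxE mulVf.
  exact: diag_mx_is_diag.
by rewrite !mulmxA mulVmx // mul1mx mulmxK // HD.2.
Qed.

Lemma det_le_entries (X : 'M[R]_k) (b : R) : 0 <= b -> (forall i j, `|X i j| <= b) ->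
  `|\det X| <= k`!%:R * b ^+ k.
Proof.
move=> b0 Xb; apply: le_trans (ler_norm_sum _ _ _) _.
apply: le_trans (ler_sum _ (G := fun _ => b ^+ k) _) _.
  move=> s _; rewrite normrM normr_sign mul1r normr_prod.
  rewrite -[X in b ^+ X](card_ord k) -prodr_const.
  by apply: ler_prod => i _; rewrite normr_ge0 Xb.
by rewrite sumr_const perm.card_Sn [leRHS]mulr_natl.
Qed.

End Orbits.

(** * The Vandermonde representatives *)

Section Bform.
Variable R : realType.
Variable n : nat.
Implicit Types X Y Z : 'M[R]_n.

Lemma trLD X Y : trL (X + Y) = trL X + trL Y.
Proof. by rewrite /trL mxtraceD mulrDr. Qed.

Lemma trLZ (a : R) X : trL (a *: X) = a * trL X.
Proof. by rewrite /trL mxtraceZ mulrCA. Qed.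

Lemma Bform_sym X Y : Bform X Y = Bform Y X.
Proof. by rewrite /Bform /trL mxtrace_mulC [X in _ - X]mulrC. Qed.

Lemma BformDl X Y Z : Bform (X + Y) Z = Bform X Z + Bform Y Z.
Proof. by rewrite /Bform mulmxDl !trLD; ring. Qed.

Lemma BformZl (a : R) X Z : Bform (a *: X) Z = a * Bform X Z.
Proof. by rewrite /Bform -scalemxAl !trLZ; ring. Qed.

(** The identity lies in the radical, which is why the form descends to the quotient by scalars. *)
Lemma Bform1l Z : Bform 1%:M Z = 0.
Proof. by rewrite /Bform mul1mx; ring. Qed.

Lemma Bform_comb (I : finType) (a : R) (u : I -> R) (M : I -> 'M[R]_n) Z :
  Bform (a *: 1%:M + \sum_i u i *: M i) Z = \sum_i u i * Bform (M i) Z.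
Proof.
rewrite BformDl BformZl Bform1l mulr0 add0r.
apply: (big_ind2 (fun X x => Bform X Z = x)) => [|X x Y y <- <-|i _].
- by rewrite /Bform mul0mx /trL mxtrace0; ring.
- exact: BformDl.
- exact: BformZl.
Qed.

End Bform.

Section Vandermonde.
Variable R : realType.
Variables k m : nat.
Local Notation n := k.+1.
Hypothesis k_gt0 : (0 < k)%N.
Hypothesis m_ge6 : (6 <= m)%N.
Variable al : 'rV[R]_n.
Local Notation mR := (m%:R : R).
Local Notation node := (@node R k m).
Hypothesis al_node : forall j, `|al ord0 j - node j| <= 5^-1.
Hypothesis al_prod : forall j, \prod_(i < n) (al ord0 j - node i) = 1.

Local Notation g := (Vandermonde n al).

(** All differences of roots are at least [m / 2 >= 1]; one of them is kept, the others are bounded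
    below by 1. *)
Lemma vdm_det_ge : mR / 2 <= `|\det g|.
Proof.
have m6 : 6 <= mR by rewrite ler_nat.
have h1 (i j : 'I_n) : (i < j)%N -> mR / 2 <= `|al ord0 j - al ord0 i|.
  by move=> ij; apply: al_sub_al => //; rewrite -val_eqE neq_ltn ij.
have h2 (i j : 'I_n) : (i < j)%N -> 1 <= `|al ord0 j - al ord0 i|.
  by move=> /h1; apply: le_trans; lra.
have P1 (I : finType) (P : pred I) (f : I -> R) : (forall i, P i -> 1 <= f i) ->
    1 <= \prod_(i | P i) f i.
  move=> f1; apply: (big_ind (fun x : R => 1 <= x)) => // a b; exact: mulr_ege1.
rewrite det_Vandermonde normr_prod (bigD1 ord0) //= normr_prod.
have l0 : (ord0 < (ord_max : 'I_n))%N by [].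
rewrite (bigD1 ord_max) //= -mulrA -[mR / 2]mulr1.
apply: ler_pM => //; first exact: h1.
apply: mulr_ege1; first by apply: (P1) => j /andP[j0 _]; exact: h2.
by apply: (P1) => i _; rewrite normr_prod; apply: (P1) => j; exact: h2.
Qed.

Lemma vdm_unit : g \in unitmx.
Proof.
rewrite unitmxE unitfE -normr_gt0; apply: lt_le_trans vdm_det_ge.
by rewrite divr_gt0 // ltr0n; case: m m_ge6.
Qed.

Lemma vdm_row0 j : g ord0 j = 1.
Proof. by rewrite mxE expr0. Qed.

(* [al] is the spectrum of the companion matrix of
   [prod_i (X - node i) - 1]. *)
Lemma eint_al : eint g al.
Proof.
have [p pE] := monic_relation R k m.
pose C : 'M[R]_n := \matrix_(i, j) if (i.+1 < n)%N then (j == i.+1 :> nat)%:R else (p j)%:~R.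
suff CE : conjd g al = C.
  rewrite /eint CE => i j; rewrite mxE; case: ifP => _; last exact: intr_int.
  by rewrite rpred_nat.
apply: (can_inj (mulmxK vdm_unit)); rewrite conjd_sym ?vdm_unit //.
apply/matrixP => i j; rewrite mul_mx_diag !mxE -exprSr.
case: (ltnP i.+1 n) => [lt|ge].
  rewrite (bigD1 (Ordinal lt)) //= big1 ?addr0 => [|l li]; rewrite !mxE.
    by rewrite lt eqxx mul1r.
  by rewrite lt -[(l == _ :> nat)]/(l == Ordinal lt) (negPf li) mul0r.
have -> : i.+1 = n by apply/eqP; rewrite eqn_leq ge ltn_ord.
rewrite pE //; apply: eq_bigr => l _; rewrite !mxE ifF //.
by apply/negbTE; rewrite -leqNgt.
Qed.

(** The rows of [g] are the powers of [al], so the lattice they span is the order [Z[al]], and its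
    elements are eigenvalue tuples of integer matrices. *)
Lemma eint_vdm_comb (c : 'rV[int]_n) : eint g (map_mx intr c *m g).
Proof.
rewrite mulmx_sum_row; apply: eint_sum; first exact: vdm_unit.
move=> i; apply: eintZ; first by rewrite mxE intr_int.
have -> : row i g = \row_j (al ord0 j ^+ i) by apply/rowP => j; rewrite !mxE.
by apply: eint_exp; [exact: vdm_unit|exact: eint_al].
Qed.

Definition unitrow (i : 'I_n) : 'rV[R]_n := \row_j (al ord0 j - node i).

Lemma eint_unitrow i : eint g (unitrow i).
Proof.
have -> : unitrow i = al - const_mx (node i) by apply/rowP => j; rewrite !mxE.
apply: eintB; first exact: eint_al.
by apply: eint_const; [exact: vdm_unit|rewrite /node rpred_nat].
Qed.

(** The norm of this element and that of the product of the others are both at least 1 in absolute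
    value, and they multiply to 1. *)
Lemma prod_unitrow i : `|\prod_j unitrow i ord0 j| = 1.
Proof.
have u0 i' j : unitrow i' ord0 j != 0 by rewrite mxE al_unit.
pose v : 'rV[R]_n := \row_j \prod_(i' | i' != i) unitrow i' ord0 j.
have ev : eint g v by apply: eint_prod; [exact: vdm_unit|exact: eint_unitrow].
have uv : (\prod_j unitrow i ord0 j) * \prod_j v ord0 j = 1.
  rewrite -big_split /= big1 // => j _.
  rewrite -[RHS](al_prod j) (bigD1 i) //= !mxE; congr (_ * _).
  by apply: eq_bigr => i' _; rewrite mxE.
have g1 := eint_norm_ge1 vdm_unit (eint_unitrow i) (u0 i).
have g2 : 1 <= `|\prod_j v ord0 j|.
  by apply: (eint_norm_ge1 vdm_unit ev) => j; rewrite mxE; apply/prodf_neq0 => i' _.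
have := congr1 Num.norm uv; rewrite normrM normr1 => E.
apply/eqP; rewrite eq_le g1 andbT -[leRHS]E ler_peMr //.
Qed.

Lemma row_logmx_stab i : stab_vec g (row i (logmx m al)).
Proof.
set a := lift ord_max i : 'I_n.
have u0 j : al ord0 j - node a != 0 by exact: al_unit.
apply/stab_vecE; apply/inGammaR_conjd; first exact: vdm_unit.
(* The scalar by which the squared unit was divided to make its last entry 1. *)
pose l := (al ord0 ord_max - node a) ^- 2.
have l0 : l != 0 by rewrite invr_neq0 // expf_neq0.
have lE j : l^-1 * arow (row i (logmx m al)) ord0 j = (al ord0 j - node a) ^+ 2.
  rewrite /l invrK; case: (unliftP ord_max j) => [j'|] ->; last by rewrite arow_max mulr1.
  rewrite arow_lift !mxE mulrBr expRB -!/a /logu.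
  rewrite !expRM_natl !lnK ?posrE ?normr_gt0 ?u0 // !real_normK ?num_real //.
  by rewrite mulrC divfK // expf_neq0.
exists l => //; split.
  have -> : l^-1 *: arow (row i (logmx m al)) = mulrow (unitrow a) (unitrow a).
    by apply/rowP => j; rewrite mxE lE !mxE expr2.
  by apply: eintM; [exact: vdm_unit|exact: eint_unitrow|exact: eint_unitrow].
under eq_bigr do rewrite lE.
rewrite (eq_bigr (fun j => unitrow a ord0 j ^+ 2)) => [|j _]; last by rewrite mxE.
by rewrite prodrXl normrX prod_unitrow expr1n.
Qed.

Definition powmx (i : 'I_k) : 'M[R]_n := conjd g (\row_j (al ord0 j ^+ i.+1)).

Lemma powmx_intlat i : intlat g (powmx i).
Proof.
split; first by apply: eint_exp; [exact: vdm_unit|exact: eint_al].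
rewrite /powmx /conjd !mulmxA mulVmx ?vdm_unit // mul1mx mulmxKV ?vdm_unit //.
Qed.

(** A relation modulo scalars is a row vector, with [- q] as coefficient of the power 0, that is
    killed by the invertible Vandermonde matrix. *)
Lemma powmx_indep (v : 'rV[R]_k) (q : R) :
  \sum_i v ord0 i *: powmx i = q *: 1%:M -> v = 0.
Proof.
move=> vq.
pose y : 'rV[R]_n := \row_i (if unlift ord0 i is Some i' then v ord0 i' else - q).
have yg : y *m g = 0.
  apply/rowP => j; rewrite !mxE big_ord_recl !mxE unlift_none expr0 mulr1.
  have E : conjd g (\sum_i v ord0 i *: \row_j (al ord0 j ^+ i.+1)) = conjd g (q *: const_mx 1).
    rewrite -conjdZ conjd1 ?vdm_unit // -vq /conjd linear_sum mulmx_sumr mulmx_suml.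
    by apply: eq_bigr => i _; rewrite /powmx conjdZ.
  have {}E : \sum_i v ord0 i *: \row_j (al ord0 j ^+ i.+1) = q *: const_mx 1 :> 'rV[R]_n.
    have : diag_mx (\sum_i v ord0 i *: \row_j (al ord0 j ^+ i.+1)) =
           diag_mx (q *: const_mx 1 : 'rV[R]_n).
      have := congr1 (fun M => invmx g *m (M *m g)) E.
      by rewrite /= !conjd_sym ?vdm_unit // !mulKmx ?vdm_unit.
    move=> /matrixP D; apply/rowP => l; have := D l l.
    by rewrite !mxE eqxx !mulr1n.
  have := congr1 (fun x : 'rV[R]_n => x ord0 j) E.
  rewrite !mxE mulr1 summxE => <-; rewrite addrC; apply/eqP; rewrite subr_eq0; apply/eqP.
  by apply: eq_bigr => i _; rewrite !mxE liftK lift0.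
have y0 : y = 0 by rewrite -[y](mulmxK vdm_unit) yg mul0mx.
apply/rowP => i; have := congr1 (fun x : 'rV[R]_n => x ord0 (lift ord0 i)) y0.
by rewrite !mxE liftK.
Qed.

Lemma powmx_Bform i j :
  `|Bform (powmx i) (powmx j)| <= 2 * n%:R ^+ 4 * (n%:R * mR) ^+ (2 * n).
Proof.
set A := n%:R * mR.
have A1 : 1 <= A by rewrite /A -natrM ler1n muln_gt0; case: m m_ge6.
have A0 : 0 <= A by apply: le_trans A1.
have trp e : (e <= 2 * n)%N -> forall x : 'rV[R]_n, (forall j, x ord0 j = al ord0 j ^+ e) ->
    `|trL (conjd g x)| <= n%:R ^+ 2 * A ^+ e.
  move=> _ x xE; rewrite /trL tr_conjd ?vdm_unit // normrM normr_nat expr2 -mulrA.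
  rewrite ler_wpM2l //; apply: le_trans (ler_norm_sum _ _ _) _.
  apply: le_trans (ler_sum _ (G := fun _ => A ^+ e) _) _.
    by move=> l _; rewrite xE normrX lerXn2r ?nnegrE // al_le.
  by rewrite sumr_const card_ord [leRHS]mulr_natl.
have t1 : trL (1%:M : 'M[R]_n) = n%:R ^+ 2 by rewrite /trL mxtrace1 expr2.
have h1 : `|trL (powmx i *m powmx j)| <= n%:R ^+ 2 * A ^+ (i.+1 + j.+1).
  rewrite /powmx conjdM ?vdm_unit //; apply: trp => [|l].
    by rewrite mul2n -addnn leq_add // ltnS ltnW.
  by rewrite !mxE exprD.
have h2 l : `|trL (powmx l)| <= n%:R ^+ 2 * A ^+ l.+1.
  apply: trp => [|l']; last by rewrite mxE.
  by rewrite mul2n -addnn (leq_trans (ltn_ord l)) // (leq_trans (leqnSn k)) // leq_addr.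
rewrite /Bform t1; apply: le_trans (ler_normB _ _) _.
rewrite [X in X + _]normrM [X in _ + X]normrM [`|n%:R ^+ 2|]ger0_norm ?exprn_ge0 //.
have -> : 2 * n%:R ^+ 4 * A ^+ (2 * n) =
  n%:R ^+ 2 * (n%:R ^+ 2 * A ^+ (2 * n)) + n%:R ^+ 2 * (n%:R ^+ 2 * A ^+ (2 * n)) by ring.
have le2n : A ^+ (i.+1 + j.+1) <= A ^+ (2 * n).
  by rewrite ler_weXn2l // mul2n -addnn leq_add // ltnS ltnW.
apply: lerD.
  rewrite ler_wpM2l ?exprn_ge0 //; apply: le_trans h1 _.
  by rewrite ler_wpM2l ?exprn_ge0.
apply: le_trans (ler_pM _ _ (h2 i) (h2 j)) _ => //.
by rewrite mulrACA [leRHS]mulrA -[A ^+ i.+1 * _]exprD ler_wpM2l ?mulr_ge0 ?exprn_ge0.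
Qed.

(** Modulo scalars the powers of the companion matrix are integer combinations, with matrix [U], of
    any basis [M]. Their Gram determinant is [det(U)^2] times that of [M], and [det U] is a nonzero
    integer by independence. *)
Lemma disc_basis_le M : disc_basis g M ->
  `|\det (\matrix_(i < k, j < k) Bform (M i) (M j))| <=
  k`!%:R * (2 * n%:R ^+ 4 * (n%:R * mR) ^+ (2 * n)) ^+ k.
Proof.
move=> [Mint [Mspan _]].
have /choice[c0 /choice[c cE]] i := Mspan _ (powmx_intlat i).
pose U : 'M[R]_k := \matrix_(i, j) (c i j)%:~R.
have pE i : powmx i = (c0 i)%:~R *: 1%:M + \sum_j U i j *: M j.
  rewrite [LHS]cE scaler_int; congr (_ + _); apply: eq_bigr => j _.
  by rewrite mxE scaler_int.
pose G : 'M[R]_k := \matrix_(i, j) Bform (M i) (M j).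
have gram : \matrix_(i < k, j < k) Bform (powmx i) (powmx j) = U *m G *m U^T.
  apply/matrixP => i j; rewrite mxE pE Bform_comb.
  rewrite -mulmxA mxE; apply: eq_bigr => a _; congr (_ * _).
  rewrite Bform_sym pE Bform_comb mxE; apply: eq_bigr => b _.
  by rewrite !mxE Bform_sym mulrC.
have detU : \det U != 0.
  apply/negP => /det0P[v v0 vU]; move/negP: v0; apply; apply/eqP.
  apply: (@powmx_indep v (\sum_i v ord0 i * (c0 i)%:~R)).
  have s0 : \sum_i v ord0 i *: (\sum_j U i j *: M j) = 0.
    under eq_bigr do rewrite scaler_sumr.
    rewrite exchange_big big1 // => j _; under eq_bigr do rewrite scalerA.
    rewrite -scaler_suml; have := congr1 (fun x : 'rV[R]_k => x ord0 j) vU.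
    by rewrite /= mxE [RHS]mxE => ->; rewrite scale0r.
  under eq_bigr do rewrite pE scalerDr scalerA.
  by rewrite big_split /= s0 addr0 -scaler_suml.
have U1 : 1 <= `|\det U|.
  apply: int_norm_ge1 => //; apply: intmx_det => i j; rewrite mxE; exact: intr_int.
have -> : \matrix_(i < k, j < k) Bform (M i) (M j) = G by [].
apply: le_trans (_ : `|\det (U *m G *m U^T)| <= _).
  rewrite !det_mulmx det_tr !normrM mulrAC ler_peMl // mulr_ege1 //.
rewrite -gram; apply: det_le_entries => [|i j].
  by rewrite !mulr_ge0 ?exprn_ge0 // mulr_ge0.
rewrite mxE; exact: powmx_Bform.
Qed.

End Vandermonde.

(** From [m] to [m'] every gap between nodes grows by at least 1, while the four errors of [1/5] add
    up to [4/5]; so every difference of roots grows strictly. *)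
Lemma vdm_det_lt (R : realType) (k m m' : nat) (al al' : 'rV[R]_k.+1) :
  (0 < k)%N -> (6 <= m)%N -> (m < m')%N ->
  (forall j, `|al ord0 j - node R m j| <= 5^-1) ->
  (forall j, `|al' ord0 j - node R m' j| <= 5^-1) ->
  `|\det (Vandermonde k.+1 al)| < `|\det (Vandermonde k.+1 al')|.
Proof.
move=> k0 m6 mm' aln aln'.
have m'6 : (6 <= m')%N by apply: leq_trans (ltnW mm').
have lt (i j : 'I_k.+1) : (i < j)%N -> `|al ord0 j - al ord0 i| < `|al' ord0 j - al' ord0 i|.
  move=> ij.
  have a := aln i; have b := aln j; have a' := aln' i; have b' := aln' j.
  have nE m0 : node R m0 j - node R m0 i = (j - i)%:R * m0%:R.
    by rewrite /node -natrB ?leq_mul2r ?(ltnW ij) ?orbT // -mulnBl natrM.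
  have d1 : 1 <= (j - i)%:R :> R by rewrite ler1n subn_gt0.
  have mm1 : m%:R + 1 <= m'%:R :> R by rewrite natr1 ler_nat.
  have E1 := nE m; have E2 := nE m'.
  have h : (j - i)%:R * m%:R + 1 <= (j - i)%:R * m'%:R :> R by nra.
  have p0 : 0 <= (j - i)%:R * m%:R :> R by rewrite mulr_ge0.
  move: a b a' b'; rewrite !ler_norml => /andP[a1 a2] /andP[b1 b2] /andP[a3 a4] /andP[b3 b4].
  rewrite [X in _ < X]ger0_norm; last by lra.
  rewrite ltr_norml; apply/andP; split; lra.
have pos (i j : 'I_k.+1) : (i < j)%N -> 0 < `|al' ord0 j - al' ord0 i|.
  by move=> /lt; apply: le_lt_trans.
rewrite !det_Vandermonde !normr_prod.
have l0 : (ord0 < (ord_max : 'I_k.+1))%N by [].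
have posr (i : 'I_k.+1) : 0 < `|\prod_(j < k.+1 | (i < j)%N) (al' ord0 j - al' ord0 i)|.
  by rewrite normr_prod prodr_gt0 // => j; exact: pos.
have ler (i : 'I_k.+1) : `|\prod_(j < k.+1 | (i < j)%N) (al ord0 j - al ord0 i)| <=
             `|\prod_(j < k.+1 | (i < j)%N) (al' ord0 j - al' ord0 i)|.
  by rewrite !normr_prod; apply: ler_prod => j /lt /ltW ->; rewrite normr_ge0.
rewrite (bigD1 ord0) //= [X in _ < X](bigD1 ord0) //=.
apply: le_lt_trans (_ : _ <= `|\prod_(j < k.+1 | (0 < j)%N) (al ord0 j - al ord0 ord0)| *
   \prod_(i < k.+1 | i != ord0) `|\prod_(j < k.+1 | (i < j)%N) (al' ord0 j - al' ord0 i)|) _.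
  by rewrite ler_wpM2l //; apply: ler_prod => i _; rewrite normr_ge0 ler.
rewrite ltr_pM2r; last by apply: prodr_gt0 => i _; exact: posr.
rewrite !normr_prod (bigD1 ord_max) //= [X in _ < X](bigD1 ord_max) //=.
apply: le_lt_trans (_ : _ <= `|al ord0 ord_max - al ord0 ord0| *
   \prod_(i < k.+1 | (0 < i)%N && (i != ord_max)) `|al' ord0 i - al' ord0 ord0|) _.
  by rewrite ler_wpM2l //; apply: ler_prod => i /andP[i0 _]; rewrite normr_ge0 ltW // lt.
rewrite ltr_pM2r ?lt //; apply: prodr_gt0 => i /andP[i0 _]; exact: pos.
Qed.

(** * Equidistribution of torsion points and the cusp *)

Section Equidistribution.
Variable R : realType.
Variable k : nat.
Implicit Types (V W : 'M[R]_k).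
Local Notation zr := (map_mx (intr : int -> R)).

Definition gridrow N (j : {ffun 'I_k -> 'I_N}) : 'rV[R]_k :=
  \row_i ((j i)%:R / N%:R).

(* [N = 1 mod |det A|] makes [A] invertible modulo [N], hence a permutation of
   the torsion points [N^-1 Z^k / Z^k]. *)
Lemma sum_grid_change (F : 'rV[R]_k -> R) V (A : 'M[int]_k) (q : nat) :
  let N := (q * `|\det A|).+1 in
  (forall t (c : 'rV[int]_k), F (t + zr c *m V) = F t) ->
  \sum_(j : {ffun 'I_k -> 'I_N}) F (gridrow j *m (zr A *m V)) =
  \sum_(j : {ffun 'I_k -> 'I_N}) F (gridrow j *m V).
Proof.
move=> N Fper.
have N0 : N%:R != 0 :> R by rewrite pnatr_eq0.
have NZ0 : (N%:Z != 0) by [].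
pose jA (j : {ffun 'I_k -> 'I_N}) : 'rV[int]_k := (\row_i (j i : nat)%:Z) *m A.
have modN j i : (`|(jA j ord0 i %% N%:Z)%Z| < N)%N.
  by rewrite -ltz_nat gez0_abs ?modz_ge0 // ltz_pmod.
pose h (j : {ffun 'I_k -> 'I_N}) : {ffun 'I_k -> 'I_N} := [ffun i => Ordinal (modN j i)].
have hE j i : ((h j i : nat)%:Z = (jA j ord0 i %% N%:Z)%Z).
  by rewrite ffunE /= gez0_abs ?modz_ge0.
have hinj : injective h.
  move=> j j' jj'.
  pose u : 'rV[int]_k := (\row_i (j i : nat)%:Z) - \row_i (j' i : nat)%:Z.
  have udiv i : (N%:Z %| (u *m A) ord0 i)%Z.
    have := hE j i; rewrite jj' hE => /esym/eqP; rewrite eqz_mod_dvd.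
    by rewrite /u mulmxBl /jA [X in _ -> (_ %| X)%Z]mxE [X in _ -> (_ %| _ + X)%Z]mxE.
  (* Multiplication by the adjugate turns divisibility of [u A] by [N] into divisibility of
     [u det A]; the second factor is then removed by coprimality. *)
  have udet i : (N%:Z %| u ord0 i * \det A)%Z.
    have -> : u ord0 i * \det A = (u *m A *m \adj A) ord0 i.
      by rewrite -mulmxA mul_mx_adj mul_mx_scalar [RHS]mxE mulrC.
    by rewrite mxE; apply: rpred_sum => l _; apply: dvdz_mulr; exact: udiv.
  have cop : coprimez N%:Z (\det A).
    by rewrite coprimezE /= /N -addn1 coprime_sym /coprime gcdnMDl gcdn1.
  apply/ffunP => i; apply: val_inj => /=.
  have := udet i; rewrite Gauss_dvdzl // /u !mxE.
  have := ltn_ord (j i); have := ltn_ord (j' i).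
  rewrite dvdzE absz_nat; move: (val (j i)) (val (j' i)) => a b bN aN dv.
  have : (`|a%:Z - b%:Z| < N)%N by lia.
  move=> lt; have := dvdn_leq _ dv; case: (posnP `|a%:Z - b%:Z|) => [|pos]; first by lia.
  by move=> /(_ isT); lia.
rewrite [RHS](reindex h) /=; last exact: onW_bij (injF_bij hinj).
apply: eq_bigr => j _.
pose c : 'rV[int]_k := \row_i (jA j ord0 i %/ N%:Z)%Z.
rewrite -(Fper (gridrow (h j) *m V) c) -mulmxDl mulmxA; congr (F (_ *m V)).
apply/rowP => i; rewrite [RHS]mxE [X in _ = X + _]mxE [X in _ = _ + X]mxE [X in _ = _ + X%:~R]mxE.
have E : ((h j i : nat)%:R : R) = (jA j ord0 i)%:~R - (jA j ord0 i %/ N%:Z)%Z%:~R * N%:R.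
  have -> : ((h j i : nat)%:R : R) = ((h j i : nat)%:Z)%:~R by [].
  by rewrite hE /modz intrB intrM.
rewrite E mulrBl mulfK // subrK /jA !mxE rmorph_sum /= mulr_suml.
by apply: eq_bigr => l _; rewrite !mxE intrM mulrAC.
Qed.

(* The box [0, eps]^k carries a proportion at least [eps^k] of the grid. *)
Lemma sum_grid_le (F : 'rV[R]_k -> R) W (N : nat) (eps : R) : (0 < N)%N ->
  0 <= eps < 1 -> (forall t, 0 <= F t <= 1) ->
  (forall s : 'rV[R]_k, (forall i, 0 <= s ord0 i <= eps) -> F (s *m W) = 0) ->
  N%:R^-1 ^+ k * \sum_(j : {ffun 'I_k -> 'I_N}) F (gridrow j *m W) <= 1 - eps ^+ k.
Proof.
move=> N0 /andP[eps0 eps1] F01 Feps.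
have NR : 0 < N%:R :> R by rewrite ltr0n.
(* Per coordinate, the grid points [0/N, ..., M/N] lie in [[0, eps]]; there are [M + 1 > eps N] of
   them. *)
pose M := Num.truncn (eps * N%:R).
have M0 : 0 <= eps * N%:R by rewrite mulr_ge0 // ltW.
have /andP[M1 M2] := truncn_itv M0.
have MN : (M < N)%N.
  by rewrite -(ltr_nat R); apply: le_lt_trans M1 _; rewrite gtr_pMl.
pose S := [pred j : {ffun 'I_k -> 'I_N} | [forall i, (j i < M.+1)%N]].
have cS : (M.+1 ^ k <= #|S|)%N.
  pose w (j : {ffun 'I_k -> 'I_M.+1}) : {ffun 'I_k -> 'I_N} := [ffun i => widen_ord MN (j i)].
  have winj : injective w.
    move=> j j' /ffunP jj'; apply/ffunP => i; apply: val_inj.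
    by have := congr1 val (jj' i); rewrite !ffunE.
  rewrite -[X in (X <= _)%N](_ : #|{ffun 'I_k -> 'I_M.+1}| = _); last first.
    by rewrite card_ffun !card_ord.
  rewrite -(card_codom winj); apply: subset_leq_card; apply/fintype.subsetP => _ /codomP[j ->].
  by rewrite inE; apply/forallP => i; rewrite ffunE /= ltn_ord.
have le1 : \sum_(j : {ffun 'I_k -> 'I_N}) F (gridrow j *m W) <= N%:R ^+ k - M.+1%:R ^+ k.
  have -> : N%:R ^+ k = \sum_(j : {ffun 'I_k -> 'I_N}) 1 :> R.
    by rewrite sumr_const card_ffun !card_ord natrX.
  rewrite (bigID S) /= [X in _ <= X - _](bigID S) /= big1 => [|j /forallP jS].
    rewrite add0r addrAC -[leLHS]add0r lerD //; last first.
      by apply: ler_sum => j _; case/andP: (F01 (gridrow j *m W)).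
    rewrite subr_ge0 sumr_const -natrX.
    by rewrite ler_nat; apply: leq_trans cS _; rewrite (eq_card (B := S)).
  apply: Feps => i; rewrite mxE divr_ge0 //= ler_pdivrMr //.
  apply: le_trans M1; by rewrite ler_nat -ltnS.
rewrite exprVn mulrC ler_pdivrMr ?exprn_gt0 // mulrBl mul1r.
apply: le_trans le1 _; rewrite lerD2l lerN2 -exprMn.
by rewrite lerXn2r ?nnegrE // ltW.
Qed.

End Equidistribution.

Section CuspExcursion.
Variable R : realType.
Variable k : nat.
Local Notation n := k.+1.

(* The lattice spanned by the rows of [g] contains [(1, ..., 1)], which is
   short relative to the covolume [|det g|]. *)
Lemma cusp_bound (K : set 'M[R]_n) : compact K -> K `<=` GLR (n := n) ->
  exists2 B : R, 0 < B & forall (g : 'M[R]_n) (d : 'rV[R]_n) (tau : R)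
      (c : 'M[R]_n) (l : R) (k0 : 'M[R]_n),
    (forall j, g ord0 j = 1) -> (forall j, expR (- tau) <= `|d ord0 j| <= expR tau) ->
    GLZ c -> K k0 -> g *m diag_mx d = l *: (c *m k0) ->
    `|\det g| <= B * expR (tau *+ (2 * n)).
Proof.
move=> cK KG.
have bnd (f : 'M[R]_n -> 'M[R]_n) : (forall M, K M -> continuous_at M f) ->
    exists2 B : R, 0 < B & forall M, K M -> forall i j, `|f M i j| <= B.
  move=> cf.
  have cfK : compact [set f x | x in K].
    apply: continuous_compact => //; apply: continuous_in_subspaceT => x /set_mem Kx.
    exact: cf.
  have [B [_ HB]] := compact_bounded cfK.
  exists (`|B| + 1); first by rewrite ltr_wpDl.
  move=> M KM i j; have Blt : B < `|B| + 1 by rewrite (le_lt_trans (ler_norm B)) ?ltrDl.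
  have := HB _ Blt (f M) (ex_intro2 _ _ M KM erefl).
  apply: le_trans; rewrite /Num.norm /= mx_normrE.
  by apply: (le_bigmax _ (fun ij : 'I_n * 'I_n => `|f M ij.1 ij.2|) (i, j)).
have [B1 B10 HB1] := bnd id (fun M _ => @cvg_id _ _).
have [B2 B20 HB2] := bnd (@invmx R n) (fun M KM => @continuous_invmx R n M (KG M KM)).
pose C1 := n`!%:R * B1 ^+ n; pose C2 := n%:R * B2.
have C20 : 0 < C2 by rewrite mulr_gt0 // ltr0n.
have C10 : 0 < C1 by rewrite mulr_gt0 ?exprn_gt0 // ltr0n fact_gt0.
exists (C1 * C2 ^+ n) => [|g d tau c l k0 g1 dtau cG Kk0 gE].
  by rewrite mulr_gt0 // exprn_gt0.
have uk0 : k0 \in unitmx := KG _ Kk0.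
have dE j : d ord0 j = l * (row ord0 c *m k0) ord0 j.
  have <- : (g *m diag_mx d) ord0 j = d ord0 j by rewrite mul_mx_diag mxE g1 mul1r.
  by rewrite gE mxE -row_mul [X in _ = _ * X]mxE.
(* The short vector [d] equals [l] times a lattice vector of [c k0]. Multiplying by the bounded
   inverse of [k0] gives [l] times a nonzero integer row, one entry of which is at least [|l|] in
   absolute value. *)
have lle : `|l| <= C2 * expR tau.
  have [i ci] : exists i, c ord0 i != 0.
    apply/not_existsP => H; have := GLZ_unit cG; rewrite unitmxE unitfE => /negP; apply.
    apply/det0P; exists (delta_mx ord0 ord0).
      by apply/eqP => /matrixP /(_ ord0 ord0); rewrite !mxE !eqxx => /eqP; rewrite oner_eq0.
    rewrite -rowE; apply/rowP => j; rewrite !mxE; apply/eqP; apply: contraPT (H j).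
    by move=> cj; rewrite cj.
  have c1 : 1 <= `|c ord0 i| by apply: int_norm_ge1 => //; exact: cG.1.
  have E : l * c ord0 i = \sum_j d ord0 j * invmx k0 j i.
    have -> : c ord0 i = (row ord0 c *m k0 *m invmx k0) ord0 i by rewrite mulmxK // mxE.
    rewrite [X in l * X]mxE mulr_sumr; apply: eq_bigr => j _.
    by rewrite mulrA -dE.
  apply: le_trans (_ : `|l * c ord0 i| <= _); first by rewrite normrM ler_peMr.
  rewrite E; apply: le_trans (ler_norm_sum _ _ _) _.
  apply: le_trans (ler_sum _ (G := fun _ => expR tau * B2) _) _.
    move=> j _; rewrite normrM ler_pM //; first by case/andP: (dtau j).
    exact: HB2.
  by rewrite sumr_const card_ord -[leLHS]mulr_natl /C2 mulrAC mulrA.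
have detE : `|\det g| * \prod_j `|d ord0 j| = `|l| ^+ n * `|\det k0|.
  have := congr1 (fun M => `|\det M|) gE.
  by rewrite /= det_mulmx det_diag detZ det_mulmx !normrM normrX cG.2 mul1r normr_prod.
have dk : `|\det k0| <= C1 by apply: det_le_entries; [exact: ltW|exact: HB1].
have pd : expR (- tau) ^+ n <= \prod_j `|d ord0 j|.
  rewrite -[X in _ ^+ X](card_ord n) -prodr_const; apply: ler_prod => j _.
  by rewrite expR_ge0; case/andP: (dtau j).
have : `|\det g| * expR (- tau) ^+ n <= C1 * (C2 * expR tau) ^+ n.
  apply: le_trans (ler_wpM2l (normr_ge0 (\det g)) pd) _.
  rewrite detE mulrC ler_pM ?exprn_ge0 // lerXn2r ?nnegrE // mulr_ge0 ?expR_ge0 // ltW //.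
rewrite expRN exprVn ler_pdivrMr ?exprn_gt0 ?expR_gt0 // => /le_trans; apply.
rewrite exprMn -[tau *+ _]mulr_natl expRM_natl mul2n -addnn exprD !mulrA //.
Qed.

End CuspExcursion.

(** * Averages of a test function over an orbit *)

Section OrbitAverage.
Variable R : realType.
Variable k : nat.
Local Notation n := k.+1.
Local Notation zr := (map_mx (intr : int -> R)).

Lemma lattice_basisP (g : 'M[R]_n) (v : 'I_k -> 'rV[R]_k) :
  @lattice_basis R n g v <-> @Vmx R n v \in unitmx /\
    forall t, stab_vec g t <-> exists c : 'rV[int]_k, t = zr c *m @Vmx R n v.
Proof.
have E (c : 'I_k -> int) : \sum_(i < k) (v i) *~ (c i) = zr (\row_i c i) *m @Vmx R n v.
  rewrite mulmx_sum_row; apply: eq_bigr => i _.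
  by rewrite rowK !mxE scaler_int.
rewrite unitmxE unitfE; split=> -[d0 Lv]; split=> // t; rewrite (Lv t).
  split=> [[c ->]|[c ->]]; first by exists (\row_i c i); rewrite E.
  by exists (fun i => c ord0 i); rewrite E; congr (zr _ *m _); apply/rowP => i; rewrite mxE.
split=> [[c ->]|[c ->]]; last by exists (\row_i c i); rewrite E.
by exists (fun i => c ord0 i); rewrite E; congr (zr _ *m _); apply/rowP => i; rewrite mxE.
Qed.

Lemma norm_srow (e : {ffun 'I_k -> bool}) j : `|srow R e ord0 j| = 1.
Proof.
rewrite mxE; case: insubP => [u _ _|_]; last by rewrite normr1.
by case: (e u); rewrite ?normrN normr1.
Qed.

Lemma flow_unitmx (g : 'M[R]_n) e t : g \in unitmx ->
  g *m @sgn_mx R n e *m @a_mx R n t \in unitmx.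
Proof.
move=> ug; rewrite !unitmx_mul ug sgn_mxE a_mxE !unitmxE !det_diag !unitfE /=.
apply/andP; split; apply/prodf_neq0 => j _.
  by rewrite -normr_gt0 norm_srow.
by rewrite gt_eqF // arow_gt0.
Qed.

Lemma continuous_within_GLR (f : 'M[R]_n -> R) (x : 'M[R]_n) :
  {within GLR (n := n), continuous f} -> x \in unitmx -> continuous_at x f.
Proof.
move=> /subspace_continuousP cf ux P fP.
have := cf x ux P fP; rewrite /within /=.
have dx : \det x != 0 by rewrite -unitfE -unitmxE.
have /cvgr_neq0 /(_ dx) := @continuous_det R n x.
apply: filterS2 => y dy; apply.
by rewrite /GLR /= unitmxE unitfE.
Qed.

Variable g : 'M[R]_n.
Hypothesis ug : g \in unitmx.
Variable f : 'M[R]_n -> R.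
Hypothesis fC : Cc_X f.

Definition flow (e : {ffun 'I_k -> bool}) (t : 'rV[R]_k) : R :=
  f (g *m @sgn_mx R n e *m @a_mx R n t).

Lemma flow_periodic e t t' : stab_vec g t' -> flow e (t + t') = flow e t.
Proof.
move=> /stab_vecE[l [c [l0 [cG cE]]]].
have [finv _] := fC.
rewrite /flow -(finv c l (g *m @sgn_mx R n e *m @a_mx R n t)) //; last exact: flow_unitmx.
congr f; rewrite [RHS]scalemxAl -cE !mulmxA conjd_sym // !a_mxE sgn_mxE.
rewrite -!mulmxA !mulmx_diag arowD; congr (_ *m diag_mx _).
by apply/rowP => j; rewrite !mxE; ring.
Qed.

Lemma flow_continuous e : continuous (flow e).
Proof.
move=> t; apply: (@continuous_fun_comp _ _ _ (fun t => g *m @sgn_mx R n e *m @a_mx R n t) f).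
  apply: continuous_mulmx; first exact: cst_continuous.
  apply: continuous_mx => i j; case: (eqVneq i j) => [->|ij].
    rewrite (_ : (fun t : 'rV[R]_k => @a_mx R n t j j) = (fun t => arow t ord0 j)); last first.
      by apply/funext => t'; rewrite a_mxE mxE eqxx mulr1n.
    case: (unliftP ord_max j) => [j'|] ->.
      rewrite (_ : (fun t : 'rV[R]_k => arow t _ _) = (fun t => expR (t ord0 j'))); last first.
        by apply/funext => t'; rewrite arow_lift.
      apply: (@continuous_fun_comp _ _ _ (fun t : 'rV[R]_k => t ord0 j') expR).
        exact: coord_continuous.
      exact: continuous_expR.
    rewrite (_ : (fun t : 'rV[R]_k => arow t _ _) = (fun _ => 1)).
      exact: cst_continuous.
    by apply/funext => t'; rewrite arow_max.
  rewrite (_ : (fun t : 'rV[R]_k => @a_mx R n t i j) = (fun _ => 0)).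
    exact: cst_continuous.
  by apply/funext => t'; rewrite a_mxE mxE (negPf ij).
by apply: continuous_within_GLR; [case: fC => _ []|exact: flow_unitmx].
Qed.

Lemma flow_cube_cont e (V : 'M[R]_k) :
  cube_cont k (fun s => flow e ((\row_i s i) *m V)).
Proof.
move=> eta eta0.
have cK : compact [set v : 'rV[R]_k | forall i, `[0, 1]%classic (v ord0 i)].
  apply: (@rV_compact _ _ (fun=> `[(0 : R), 1]%classic)) => _; exact: segment_compact.
have [|d d0 dP] := compact_unif_continuous cK (F := fun x => flow e (x *m V)) _ eta0.
  move=> x _; apply: (@continuous_fun_comp _ _ _ (fun x : 'rV[R]_k => x *m V)).
    by apply: continuous_mulmx; [exact: cvg_id|exact: cst_continuous].
  exact: flow_continuous.
exists d => // s s' cs cs' ss'; apply: dP => [i|i].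
  by rewrite /= mxE in_itv /= cs.
by rewrite !mxE; apply: ss'.
Qed.

(** The vanishing is known on a box in the coordinates of [W], the average is computed in those of
    [V]. For each sign pattern the integral is approximated by a Riemann sum, which
    [sum_grid_change] rewrites in terms of [W = A V]; there [sum_grid_le] applies. *)
Lemma orbit_avg_le (v : 'I_k -> 'rV[R]_k) (W : 'M[R]_k) (eps : R) :
  @lattice_basis R n g v -> W \in unitmx -> (forall i, stab_vec g (row i W)) -> 0 <= eps < 1 ->
  (forall x, GLR x -> 0 <= f x <= 1) ->
  (forall e (s : 'rV[R]_k), (forall i, 0 <= s ord0 i <= eps) -> flow e (s *m W) = 0) ->
  @orbit_avg R n g v f <= 1 - eps ^+ k.
Proof.
move=> /lattice_basisP[uV LV] uW LW eps01 f01 Feps.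
set V := @Vmx R n v in uV LV.
have /choice[c cP] : forall i, exists c : 'rV[int]_k, row i W = zr c *m V.
  by move=> i; apply/LV.
pose A : 'M[int]_k := \matrix_i c i.
have WA : W = zr A *m V by apply/row_matrixP => i; rewrite row_mul -map_row rowK -cP.
have F01 e t : 0 <= flow e t <= 1 by apply: f01; exact: flow_unitmx.
rewrite /orbit_avg ler_pdivrMl ?exprn_gt0 //.
apply: le_trans (ler_sum _ (G := fun _ => 1 - eps ^+ k) _) _; last first.
  by rewrite sumr_const card_ffun card_bool card_ord -natrX [leRHS]mulr_natl.
move=> e _; set H := (X in cube_int _ X).
have HE : H = fun s => flow e ((\row_i s i) *m V).
  apply/funext => s; rewrite /H /flow; congr (f (_ *m a_mx _)).
  by rewrite mulmx_sum_row; apply: eq_bigr => i _; rewrite rowK mxE.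
rewrite HE; apply/ler_addgt0Pr => x x0.
have k1 : 0 < k.+1%:R :> R by rewrite ltr0n.
(* The Riemann sum is off by at most [k eta], which this keeps below [x]; the denominator is nonzero
   for every [k]. *)
pose eta := x / k.+1%:R.
have eta0 : 0 < eta by rewrite divr_gt0.
have cH := flow_cube_cont e V.
have [d d0 dP] := cH eta eta0.
(* Any [q] above [1 / d] makes the mesh finer than [d] and leaves [N = q |det A| + 1] prime to
   [det A]. *)
have [q dq] : exists q : nat, d^-1 < q%:R.
  exists (Num.truncn d^-1).+1; have d'0 : 0 <= d^-1 by rewrite invr_ge0 ltW.
  by have /andP[] := truncn_itv d'0.
have detA : (0 < `|\det A|)%N.
  rewrite absz_gt0; apply: contraTneq uW => A0.
  by rewrite WA unitmxE det_mulmx det_map_mx A0 mul0r unitr0.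
pose N := (q * `|\det A|).+1.
have N0 : 0 < N%:R :> R by rewrite ltr0n.
have Nd : N%:R^-1 < d.
  rewrite -[d]invrK ltf_pV2 ?posrE ?invr_gt0 //; apply: lt_le_trans dq _.
  by rewrite ler_nat /N; apply: leqW; apply: leq_pmulr.
have := cube_int_riem (ltn0Sn _ : (0 < N)%N) Nd cH dP.
set I := cube_int _ _ => Iriem.
have riemW : riem N k (fun s => flow e ((\row_i s i) *m V)) <= 1 - eps ^+ k.
  rewrite riemE.
  have gE (j : {ffun 'I_k -> 'I_N}) : \row_(i < k) grid_pt R j i = gridrow R j.
    by apply/rowP => i; rewrite !mxE /grid_pt valK.
  under eq_bigr do rewrite gE.
  rewrite /N -(@sum_grid_change R k (flow e) V A q) -/N.
    by rewrite -WA; apply: sum_grid_le => //; exact: Feps.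
  by move=> t c'; apply: flow_periodic; apply/LV; exists c'.
have : I <= riem N k (fun s => flow e ((\row_i s i) *m V)) + k%:R * eta.
  by rewrite -lerBlDl; apply: le_trans Iriem; exact: ler_norm.
move=> /le_trans; apply; apply: lerD => //.
by rewrite /eta mulrCA ger_pMr // ler_pdivrMr // mul1r ler_nat.
Qed.

End OrbitAverage.

(** * Uniform bounds for the family *)

Section Family.
Variable R : realType.
Variable k : nat.
Hypothesis k_gt0 : (0 < k)%N.
Local Notation n := k.+1.

Definition near_nodes m (al : 'rV[R]_n) :=
  (forall j, `|al ord0 j - node R m j| <= 5^-1) /\
  (forall j, \prod_(i < n) (al ord0 j - node R m i) = 1).

Lemma near_nodes_exists m : (6 <= m)%N -> exists al, near_nodes m al.
Proof.
move=> m6.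
have /choice[x xP] : forall j : 'I_n, exists x : R, `|x - node R m j| <= 5^-1 /\
    \prod_(i < n) (x - node R m i) = 1.
  by move=> j; have [x x1 x2] := root_near R k_gt0 m6 j; exists x.
exists (\row_j x j); split=> j; rewrite mxE; have [x1 x2] := xP j => //.
Qed.

Lemma ln_ge_eventually (X : R) : exists m0 : nat, forall m, (m0 <= m)%N -> X <= ln (m%:R : R).
Proof.
exists (Num.truncn (expR X)).+1 => m m0m.
have h : expR X < m%:R.
  have /andP[_ h] := truncn_itv (expR_ge0 X).
  by apply: lt_le_trans h _; rewrite ler_nat.
rewrite -[X]expRK ler_ln ?posrE ?expR_gt0 //; first exact: ltW.
by apply: lt_trans h; exact: expR_gt0.
Qed.

(** Divided by [- 2 n ln m], the matrix differs from the identity by at most [ln (2 n) / ln m] in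
    each entry, so its determinant is eventually at least [1/2] in absolute value. *)
Lemma logmx_det_ge : exists m0 : nat, forall m al, (m0 <= m)%N -> (6 <= m)%N ->
  near_nodes m al -> ln (m%:R : R) ^+ k / 2 <= `|\det (logmx m al)|.
Proof.
have [eta eta0 etaP] := det_near1 R k.
pose c : R := ln (2 * n%:R).
have c0 : 0 <= c by apply: ln_ge0; rewrite -natrM ler1n.
have [m0 m0P] := ln_ge_eventually (Num.max 1 (c / eta)).
exists m0 => m al mm m6 [al1 al2].
have := m0P m mm; rewrite ge_max => /andP[l1 lc].
set x : R := ln m%:R in l1 lc *.
have n1 : 1 <= n%:R :> R by rewrite ler1n.
have x0 : 0 < 2 * n%:R * x by rewrite !mulr_gt0 // ?(lt_le_trans _ l1) // ltr0n.
pose E : 'M[R]_k := - (2 * n%:R * x)^-1 *: logmx m al.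
have EE : logmx m al = - (2 * n%:R * x) *: E.
  by rewrite /E scalerA mulrNN mulfV ?scale1r // gt_eqF.
have En i j : `|E i j - (i == j)%:R| <= eta.
  have := logmx_near k_gt0 m6 al1 al2 i j; rewrite -/x -/c => H.
  have -> : E i j - (i == j)%:R = - (2 * n%:R * x)^-1 * (logmx m al i j + (2 * n%:R * x) *+ (i == j)).
    rewrite /E mxE mulrDr; congr (_ + _).
    by case: (i == j); rewrite ?mulr1n ?mulr0n ?mulr0 ?oppr0 // mulNr mulVf // gt_eqF.
  rewrite normrM.
  have -> : `|- (2 * n%:R * x)^-1| = (2 * n%:R * x)^-1.
    by rewrite normrN gtr0_norm // invr_gt0.
  rewrite [leLHS]mulrC ler_pdivrMr //.
  apply: le_trans H _; rewrite [leRHS]mulrC -!mulrA.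
  rewrite ler_wpM2l // ler_wpM2l //; rewrite ler_pdivrMr // in lc.
have dE := etaP E En.
rewrite EE detZ normrM normrX normrN (gtr0_norm x0).
apply: ler_pM => //; first by rewrite exprn_ge0 // (le_trans _ l1).
have xx : x <= 2 * n%:R * x by rewrite ler_peMl ?(le_trans _ l1) //; nra.
by rewrite lerXn2r ?nnegrE ?(ltW x0) // (le_trans _ l1).
Qed.

(* Rules out the junk value of the division by [stabF] in [orbit_vol]. *)
Lemma stabF_gt0 (g : 'M[R]_n) : g \in unitmx -> (0 < stabF g <= 2 ^ k)%N.
Proof.
move=> ug; apply/andP; split.
  apply/fintype.card_gt0P; exists [ffun=> false].
  apply: mem_set => /=; apply/asboolP; exists 0.
  rewrite sgn_mxE a_mxE arow0.
  have -> : srow R [ffun=> false] = const_mx 1 :> 'rV[R]_n.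
    by apply/rowP => j; rewrite !mxE; case: insubP => // u _ _; rewrite ffunE.
  by rewrite !diag_const_mx !mulmx1 mulmxV //; exact: inGammaR1.
apply: leq_trans (max_card _) _.
by rewrite card_ffun card_bool card_ord.
Qed.

(** Both [|det W|] and the bound on the index of [W] have order [(ln m)^k], so the logarithms cancel
    and a constant remains. The sign group contributes [2^k / stabF >= 1]. The existence of a basis
    is recorded for use with [mu_orb]. *)
Lemma orbit_vol_ge : exists vc : R, 0 < vc /\ exists m0 : nat, forall m al, (m0 <= m)%N ->
  (6 <= m)%N -> near_nodes m al ->
  logmx m al \in unitmx /\
  (exists v, @lattice_basis R n (Vandermonde n al) v) /\
  vc <= @orbit_vol R n (Vandermonde n al).
Proof.
have [m1 m1P] := logmx_det_ge.
have [m2 m2P] := ln_ge_eventually 1.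
(* With entries at most [b = 4 n ln m] and separation [r = 1 / (8 n)], one has
   [2 k b / r = 64 k n^2 ln m]. The summand 1 absorbs the successor in [M.+1], as [ln m >= 1]. *)
pose X : R := 64 * k%:R * n%:R ^+ 2 + 1.
have X0 : 0 < X by rewrite ltr_wpDl // mulr_ge0 ?exprn_ge0 // mulr_ge0.
exists (2^-1 / X ^+ k); split; first by rewrite divr_gt0 ?exprn_gt0.
exists (maxn (2 * n) (maxn m1 m2)) => m al.
rewrite !geq_max => /andP[nm /andP[mm1 mm2]] m6 [al1 al2].
set g := Vandermonde n al; set W := logmx m al.
have ug : g \in unitmx by exact: (vdm_unit k_gt0 m6 al1).
have l1 := m2P m mm2.
have dW := m1P m al mm1 m6 (conj al1 al2).
set x : R := ln m%:R in l1 dW.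
have x0 : 0 < x by apply: lt_le_trans l1.
have uW : W \in unitmx.
  rewrite unitmxE unitfE -normr_gt0; apply: lt_le_trans dW.
  by rewrite divr_gt0 ?exprn_gt0.
have n0 : 0 < n%:R :> R by rewrite ltr0n.
pose r : R := (8 * n%:R)^-1.
have r0 : 0 < r by rewrite invr_gt0 mulr_gt0.
pose b : R := 4 * n%:R * x.
have Wb i j : `|W i j| <= b by apply: logmx_le.
have bpos : 0 <= 2 * k%:R * b / r.
  by rewrite divr_ge0 ?(ltW r0) // !mulr_ge0 // ltW.
pose M := Num.truncn (2 * k%:R * b / r).
have /andP[M1 M2] := truncn_itv bpos.
have bM : 2 * k%:R * b < M.+1%:R * r by rewrite -ltr_pdivrMr.
have LW i : stab_vec g (row i W) by apply: row_logmx_stab.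
have L0 : stab_vec g 0 by exact: stab_vec0.
have LB t t' : stab_vec g t -> stab_vec g t' -> stab_vec g (t - t') by exact: stab_vecB.
have Ls t : stab_vec g t -> (forall i, `|t ord0 i| < r) -> t = 0 by exact: stab_vec_sep.
have [V uV VP] := lattice_basis_exists L0 LB r0 Ls LW uW Wb bM.
have exv : exists v, @lattice_basis R n g v.
  exists (fun i => row i V); apply/lattice_basisP.
  have -> : @Vmx R n (fun i => row i V) = V by apply/row_matrixP => i; rewrite rowK.
  by [].
split=> //; split=> //.
(* As a basis exists, [xget] returns the volume for some basis [v], possibly other than [V];
   [covolume_ge] holds for all of them. *)
have : exists w, [set w | exists v, @lattice_basis R n g v /\
     w = 2 ^+ n.-1 * `|\det (@Vmx R n v)| / (stabF g)%:R] w.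
  by have [v Lv] := exv; exists (2 ^+ n.-1 * `|\det (@Vmx R n v)| / (stabF g)%:R); exists v.
move=> /(xgetPex 0); rewrite -/(orbit_vol g) => -[v [/lattice_basisP[uv vP] ->]].
have cov := covolume_ge L0 LB r0 Ls LW uW Wb bM uv vP.
have /andP[s0 s1] := stabF_gt0 ug.
have s0' : 0 < (stabF g)%:R :> R by rewrite ltr0n.
apply: le_trans (_ : `|\det (@Vmx R n v)| <= _); last first.
  rewrite ler_pdivlMr // mulrC ler_wpM2r //.
  by rewrite -natrX ler_nat.
have MX : (M.+1 ^ k)%:R <= (X * x) ^+ k :> R.
  rewrite natrX; rewrite lerXn2r ?nnegrE ?mulr_ge0 ?(ltW X0) ?(ltW x0) //.
  rewrite -natr1; apply: le_trans (lerD M1 l1) _.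
  rewrite le_eqVlt; apply/orP; left; apply/eqP; rewrite /X /b /r; field.
  by rewrite nat1r pnatr_eq0.
rewrite ler_pdivrMr ?exprn_gt0 //.
have xk : 0 < x ^+ k by rewrite exprn_gt0.
rewrite -(ler_pM2r xk) mulrC; apply: le_trans dW _.
apply: le_trans cov _; rewrite -mulrA -exprMn mulrC.
by rewrite ler_wpM2l.
Qed.

(** For [s] in [[0, eps]^k] with [eps = 1 / (16 k n^2)], the coordinates of [s W] are at most
    [k eps 4 n ln m = ln m / (4 n)]. A return to the support of [f] would give
    [m / 2 <= B exp(2 n tau) = B sqrt m] by [cusp_bound], hence [m <= 4 B^2], which the threshold on
    [m] excludes. *)
Lemma mu_orb_le (f : 'M[R]_n -> R) : Cc_X f -> (forall x, GLR x -> 0 <= f x <= 1) ->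
  exists m0 : nat, forall m al, (m0 <= m)%N -> (6 <= m)%N -> near_nodes m al ->
  logmx m al \in unitmx -> (exists v, @lattice_basis R n (Vandermonde n al) v) ->
  @mu_orb R n (Vandermonde n al) f <= 1 - ((16 * k%:R * n%:R ^+ 2)^-1) ^+ k.
Proof.
move=> fC f01; have [_ [_ [K [cK [KG Kf]]]]] := fC.
have [B B0 BP] := cusp_bound cK KG.
have [m1 m1P] := ln_ge_eventually (ln (4 * B ^+ 2) + 1).
exists (maxn (2 * n) m1) => m al; rewrite geq_max => /andP[nm mm1] m6 [al1 al2] uW exv.
set g := Vandermonde n al; set W := logmx m al.
have ug : g \in unitmx by exact: (vdm_unit k_gt0 m6 al1).
set eps := (16 * k%:R * n%:R ^+ 2)^-1.
have k1 : 1 <= k%:R :> R by rewrite ler1n.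
have n1 : 1 <= n%:R :> R by rewrite ler1n.
have d1 : 1 < 16 * k%:R * n%:R ^+ 2 :> R.
  have : 1 <= n%:R ^+ 2 :> R by rewrite exprn_ege1.
  nra.
have eps0 : 0 < eps by rewrite invr_gt0 (lt_trans _ d1).
have eps1 : eps < 1 by rewrite invf_lt1 // (lt_trans _ d1).
have : exists m, [set m | exists v, @lattice_basis R n g v /\ m = orbit_avg g v f] m.
  by have [v Lv] := exv; exists (orbit_avg g v f); exists v.
move=> /(xgetPex 0); rewrite -/(mu_orb g f) => -[v [Lv ->]].
apply: (orbit_avg_le ug fC Lv uW) => //.
- by move=> i; apply: row_logmx_stab.
- by rewrite (ltW eps0) eps1.
move=> e s sE; apply/eqP; apply: contraT => fne.
set t := s *m W.
have l0 : 0 <= ln (m%:R : R) by apply: lnm_ge0.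
pose tau : R := k%:R * (eps * (4 * n%:R * ln m%:R)).
have tau0 : 0 <= tau by rewrite !mulr_ge0 // ltW.
have tb i : `|t ord0 i| <= tau.
  rewrite mxE; apply: le_trans (ler_norm_sum _ _ _) _.
  apply: le_trans (ler_sum _ (G := fun _ => eps * (4 * n%:R * ln m%:R)) _) _.
    move=> j _; rewrite normrM ler_pM //; last exact: logmx_le.
    by have /andP[s0 s1] := sE j; rewrite ger0_norm.
  by rewrite sumr_const card_ord [leRHS]mulr_natl.
have [c [l [k0 [cG [_ [Kk0 gE]]]]]] := Kf _ (flow_unitmx e t ug) fne.
have gE' : g *m diag_mx (mulrow (srow R e) (arow t)) = l *: (c *m k0).
  by rewrite -gE sgn_mxE a_mxE -mulmxA mulmx_diag.
have row0 j : g ord0 j = 1 by rewrite mxE expr0.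
have db j : expR (- tau) <= `|mulrow (srow R e) (arow t) ord0 j| <= expR tau.
  rewrite mxE normrM norm_srow mul1r gtr0_norm ?arow_gt0 //; exact: arow_bound.
have := BP g _ tau c l k0 row0 db cG Kk0 gE'.
have dg : m%:R / 2 <= `|\det g| := vdm_det_ge k_gt0 m6 al1.
have tauE : tau *+ (2 * n) = ln m%:R / 2.
  rewrite -[LHS]mulr_natr /tau /eps natrM; field.
  by rewrite nat1r !pnatr_eq0 -!lt0n k_gt0.
rewrite tauE => H; have {}H := le_trans dg H.
have m0 : 0 < m%:R :> R by rewrite ltr0n; case: m m6 {nm mm1 al1 al2 uW exv g W ug fne t l0 tau tau0 tb Lv gE gE' row0 db dg tauE H s sE}.
set y := expR (ln m%:R / 2) in H.
have yy : y ^+ 2 = m%:R.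
  by rewrite /y -expRM_natl mulrC divfK // lnK.
have y0 : 0 < y by rewrite expR_gt0.
have yB : y <= 2 * B.
  have : y ^+ 2 / 2 <= B * y by rewrite yy.
  by rewrite expr2; nra.
have mB : m%:R <= 4 * B ^+ 2 by rewrite -yy; nra.
have := m1P m mm1.
rewrite -ler_ln ?posrE ?mulr_gt0 ?exprn_gt0 // in mB.
by move=> /le_trans /(_ mB); rewrite gerDl ler10.
Qed.

Lemma orbit_disc_le m al : (6 <= m)%N -> near_nodes m al ->
  @orbit_disc R n (Vandermonde n al) <=
  (k`! * (2 * n ^ 4 * n ^ (2 * n)) ^ k)%:R * m%:R ^+ (2 * n * k).
Proof.
move=> m6 [al1 al2]; rewrite /orbit_disc.
set S := (X in xget 0 X).
(* Were there no basis, [xget] would return 0, which also satisfies the bound. *)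
have [exS|nS] := pselect (exists d, S d); last first.
  have -> : xget 0 S = 0 by apply: xgetPN => d Sd; apply: nS; exists d.
  by rewrite mulr_ge0 // exprn_ge0.
have := xgetPex 0 exS; rewrite {2}/S => -[M [dM ->]].
apply: le_trans (ler_norm _) _.
apply: le_trans (disc_basis_le k_gt0 m6 al1 al2 dM) _.
rewrite le_eqVlt; apply/orP; left; apply/eqP.
have E : (2 * n ^ 4 * n ^ (2 * n))%:R = 2 * n%:R ^+ 4 * n%:R ^+ (2 * n) :> R.
  by rewrite -!natrX -!natrM.
rewrite natrM natrX E -[RHS]mulrA; congr (_ * _).
by rewrite [(n%:R * m%:R) ^+ _]exprMn mulrA exprMn -exprM.
Qed.

End Family.

(** * Choice of the sequence and of the constants *)

Lemma powR_exprK (R : realType) (D : R) (p : nat) : 0 <= D -> (0 < p)%N ->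
  (D `^ p%:R^-1) ^+ p = D.
Proof.
move=> D0 p0; rewrite -powR_mulrn ?powR_ge0 // -powRrM mulVf ?powRr1 //.
by rewrite pnatr_eq0 -lt0n.
Qed.

Theorem theorem1p6 (R : realType) (n : nat) (hn : (2 <= n)%N) :
  exists (g : nat -> 'M[R]_n) (alpha delta : R),
    0 < alpha /\ 0 < delta /\
    (forall i, periodicH (g i)) /\
    (forall i j, i <> j -> ~ same_orbit (g i) (g j)) /\
    (* (1) every weak* limit has total mass < 1 - delta *)
    (forall (phi : nat -> nat) (L : ('M[R]_n -> R) -> R),
       (forall k, (phi k < phi k.+1)%N) ->
       (forall f, Cc_X f -> mu_orb (g (phi k)) f @[k --> \oo] --> L f) ->
       (ereal_sup [set (L f)%:E | f in
          [set f : 'M[R]_n -> R | Cc_X f /\ forall x, GLR x -> (0 <= f x <= 1)%R]]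
        < (1 - delta)%:E)%E) /\
    (* (2) total volume of orbits with orbit_disc < D is >> D^alpha *)
    (exists c : R, 0 < c /\ exists D0 : R, forall D : R, D0 <= D ->
       ((c * D `^ alpha)%:E <=
          \sum_(i <oo | (orbit_disc (g i) < D)%R) (orbit_vol (g i))%:E)%E).
Proof.
case: n hn => [//|[//|k']] _; set k := k'.+1.
have k0 : (0 < k)%N by [].
have [vc [vc0 [m1 m1P]]] := orbit_vol_ge R k0.
(* 6 is for the location of the roots, [m1] for the volume bound, [2 n] for the bound on the entries
   of [logmx]. *)
pose m0 := maxn 6 (maxn m1 (2 * k.+1)).
have m0i i : [/\ (6 <= i + m0)%N, (m1 <= i + m0)%N & (2 * k.+1 <= i + m0)%N].
  by split; apply: leq_trans (leq_addl _ _); rewrite /m0 !leq_max leqnn ?orbT.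
have /choice[al alP] : forall i, exists al : 'rV[R]_k.+1, near_nodes (i + m0) al.
  by move=> i; have [m6 _ _] := m0i i; apply: near_nodes_exists.
pose g i := Vandermonde k.+1 (al i).
have ug i : g i \in unitmx.
  by have [m6 _ _] := m0i i; have [al1 al2] := alP i; exact: (vdm_unit k0 m6 al1).
(* The escaping proportion of the orbit: already the [k]-th power of the side of the box. *)
pose eps : R := ((16 * k%:R * k.+1%:R ^+ 2)^-1) ^+ k.
have eps0 : 0 < eps.
  by rewrite exprn_gt0 // invr_gt0 !mulr_gt0 ?exprn_gt0 // ltr0n.
(* The discriminants are at most [Kd m^p], so [alpha = 1 / p]. *)
pose p := (2 * k.+1 * k)%N.
have p0 : (0 < p)%N by rewrite !muln_gt0.
pose Kd := (k`! * (2 * k.+1 ^ 4 * k.+1 ^ (2 * k.+1)) ^ k)%N.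
have Kd0 : (0 < Kd)%N by rewrite !(muln_gt0, expn_gt0, fact_gt0).
(* Limits only satisfy the weak bound [1 - eps]; halving makes the inequality strict, even for the
   supremum. *)
exists g, (p%:R^-1), (eps / 2).
split; first by rewrite invr_gt0 ltr0n.
split; first by rewrite divr_gt0.
split.
  move=> i; have [m6 m1i m2i] := m0i i; have [al1 al2] := alP i.
  have [uW _] := m1P _ _ m1i m6 (alP i).
  split; first exact: ug.
  split.
    apply: (@orbit_closed R k (g i) (al i)) => //.
      exact: (eint_al k0 m6 al1 al2).
    by move=> a b; exact: (al_inj m6 al1).
  apply: (@orbit_cocompact R k (g i) (logmx (i + m0) (al i))
     (4 * k.+1%:R * ln (i + m0)%:R)) => //.
  - by rewrite !mulr_ge0 // (lnm_ge0 R m6).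
  - by move=> a b; apply: logmx_le.
  - by move=> a; exact: (row_logmx_stab k0 m6 al1 al2).
split.
  have dlt i j : (i < j)%N -> `|\det (g i)| < `|\det (g j)|.
    move=> ij; have [m6 _ _] := m0i i.
    apply: (@vdm_det_lt R k (i + m0) (j + m0)) => //; first by rewrite ltn_add2r.
      by have [] := alP i.
    by have [] := alP j.
  have dle i j : same_orbit (g i) (g j) -> `|\det (g j)| <= `|\det (g i)|.
    move=> sij; have [m6 _ _] := m0i i; have [al1 al2] := alP i.
    apply: same_orbit_det sij; first exact: ug.
      by move=> c; exact: (eint_vdm_comb k0 m6 al1 al2).
    by move=> a; exact: vdm_row0.
  move=> i j ij sij; case: (ltngtP i j) => [lt|lt|//].
    by have := dlt _ _ lt; rewrite ltNge dle.
  by have := dlt _ _ lt; rewrite ltNge dle //; exact: same_orbit_sym.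
split.
  move=> phi L phiS phiL.
  have phi_ge i : (i <= phi i)%N.
    by elim: i => // i IH; apply: leq_ltn_trans IH (phiS i).
  apply: (@le_lt_trans _ _ (1 - eps)%:E); last first.
    rewrite lte_fin ltrD2l ltrN2 ltr_pdivrMr // ltr_pMr // ltr1n //.
  apply: ge_ereal_sup => _ [f [fC f01] <-]; rewrite lee_fin.
  apply: (cvgr_to_le (phiL f fC)).
  have [m2 m2P] := mu_orb_le k0 fC f01.
  exists m2 => //= i m2i.
  have [m6 m1i _] := m0i (phi i); have [uW [exv _]] := m1P _ _ m1i m6 (alP (phi i)).
  apply: (m2P (phi i + m0)%N) => //.
  by apply: leq_trans (leq_addr _ _); apply: leq_trans m2i (phi_ge i).
have KdR : 1 <= Kd%:R :> R by rewrite ler1n.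
have m0R : 1 <= m0%:R :> R by rewrite ler1n /m0 leq_max.
exists (vc / (4 * Kd%:R)); split; first by rewrite divr_gt0 // mulr_gt0 // ltr0n.
exists ((4 * Kd%:R * m0%:R) ^+ p) => D DD.
pose X : R := 4 * Kd%:R * m0%:R.
have X0 : 0 <= X by rewrite !mulr_ge0.
have D0 : 0 <= D by apply: le_trans DD; exact: exprn_ge0.
set y := D `^ p%:R^-1.
have y0 : 0 <= y by exact: powR_ge0.
have yD : y ^+ p = D by exact: powR_exprK.
have yX : X <= y by rewrite -(ler_pXn2r p0) ?nnegrE // yD.
(* About half of the indices that [D] allows: [Kd i < y / 2] for [i < N], and [Kd m0 <= y / 4] by
   the choice of the threshold, so [Kd (i + m0) < y]. The constant is moved inside the power by
   [Kd <= Kd ^ p]. *)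
pose N := Num.truncn (y / (2 * Kd%:R)).
have K2 : 0 < 2 * Kd%:R :> R by rewrite mulr_gt0 // ltr0n.
have q0 : 0 <= y / (2 * Kd%:R) by rewrite divr_ge0 // ltW.
have /andP[N1 N2] := truncn_itv q0.
have disc i : (i < N)%N -> orbit_disc (g i) < D.
  move=> iN; have [m6 _ _] := m0i i.
  apply: le_lt_trans (orbit_disc_le k0 m6 (alP i)) _.
  have iy : Kd%:R * (i + m0)%:R < y.
    have i1 : i%:R + 1 <= y / (2 * Kd%:R).
      by apply: le_trans N1; rewrite natr1 ler_nat.
    rewrite ler_pdivlMr // in i1.
    rewrite natrD; move: yX; rewrite /X; nra.
  rewrite -yD; apply: le_lt_trans (_ : (Kd%:R * (i + m0)%:R) ^+ p < _).
    rewrite exprMn ler_wpM2r ?exprn_ge0 //.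
    by rewrite -natrX ler_nat -[X in (X <= _)%N]expn1 leq_pexp2l.
  by rewrite (ltr_pXn2r p0) ?nnegrE ?mulr_ge0.
have vol i : vc <= orbit_vol (g i).
  by have [m6 m1i _] := m0i i; have [_ [_]] := m1P _ _ m1i m6 (alP i).
have vol0 i : (0 <= (orbit_vol (g i))%:E)%E.
  by rewrite lee_fin (le_trans _ (vol i)) // ltW.
apply: le_trans (@nneseries_lim_ge R (fun i => (orbit_vol (g i))%:E)
  (fun i => orbit_disc (g i) < D) 0 N (fun i _ _ => vol0 i)).
rewrite sumEFin lee_fin big_mkord.
apply: le_trans (_ : \sum_(i < N) vc <= _); last first.
  rewrite [leRHS](eq_bigl (fun _ => true)); first by apply: ler_sum => i _; exact: vol.
  by move=> i; rewrite disc.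
rewrite sumr_const card_ord -mulrA -[leRHS]mulr_natr ler_wpM2l ?(ltW vc0) //.
(* The rounding loss of 1 is at most [y / (4 Kd)], so [N >= y / (4 Kd)]. *)
have : y / (2 * Kd%:R) = 2 * ((4 * Kd%:R)^-1 * y) by field; rewrite pnatr_eq0 -lt0n.
move=> E; have {}N2 : y / (2 * Kd%:R) < N.+1%:R := N2.
rewrite E in N2; have N3 : N.+1%:R = N%:R + 1 :> R by rewrite natr1.
have : 1 <= (4 * Kd%:R)^-1 * y.
  rewrite mulrC ler_pdivlMr ?mulr_gt0 // ?ltr0n // mul1r.
  by apply: le_trans yX; rewrite /X ler_peMr // mulr_ge0.
move: N2; rewrite N3; lra.
Qed.
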